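(* Let $(\Omega,\mu)$ be a probability space and let $p \in (1,\infty)$. If $T$ is a hypercontractive linear operator on $L^p(\Omega,\mu)$, then $r_{\mathrm{ess}}(T) < 1$.
   Context: All Banach spaces and $L^p$-spaces are over the complex scalar field. For a probability space $(\Omega,\mu)$ and $p \in (1,\infty)$, a bounded linear operator $T$ on $L^p(\Omega,\mu)$ is called hypercontractive if there is some $q \in (p,\infty)$ such that the range of $T$ is contained in $L^q(\Omega,\mu)$ and the norm of $T$ as an operator from $L^p(\Omega,\mu)$ to $L^q(\Omega,\mu)$ does not exceed $1$. The essential spectral radius $r_{\mathrm{ess}}(T)$ of a bounded linear operator $T$ on a complex Banach space is the smallest number $r \in [0,\infty)$ such that every complex number of modulus $> r$ is either in the resolvent set of $T$ or is a pole of the resolvent of $T$ and an eigenvalue of $T$ of finite algebraic multiplicity. *)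

(* Defs.v *)
From HB Require Import structures.
From mathcomp Require Import all_boot all_order all_algebra ring_quotient complex.
From mathcomp Require Import all_classical all_reals all_analysis.
From mathcomp Require Import measurable_realfun.
Set Implicit Arguments.
Unset Strict Implicit.
Unset Printing Implicit Defensive.
Import Order.TTheory GRing.Theory Num.Theory numFieldNormedType.Exports.
Import Normc.
Local Open Scope classical_set_scope.
Local Open Scope complex_scope.
Local Open Scope ring_scope.

Section complex_functions.
Context d (T : measurableType d) (R : realType).
Variable mu : {measure set T -> \bar R}.
Implicit Types (p : R) (f g : T -> R[i]) (u v : T -> R).

(* Measurability for the Borel sigma-algebra of R[i] = R^2, for which the
   library has no instance. *)
Definition cmeasurable f :=
  measurable_fun setT (@complex.Re R \o f) /\
  measurable_fun setT (@complex.Im R \o f).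

Definition cLnorm p f : \bar R := 'N[mu]_p%:E[EFin \o (@normc R \o f)]%E.

Definition cLfun p : set (T -> R[i]) :=
  [set f | cmeasurable f /\ (cLnorm p f < +oo)%E].

Lemma ae_le_Lnorm p u v : 0 < p ->
  measurable_fun setT u -> measurable_fun setT v ->
  (\forall x \ae mu, `|u x| <= `|v x|) ->
  ('N[mu]_p%:E[EFin \o u] <= 'N[mu]_p%:E[EFin \o v])%E.
Proof.
move=> p0 mu_ mv uv; rewrite unlock /Lnorm.
apply: gt0_ler_poweR; first by rewrite invr_ge0 ltW.
- by rewrite in_itv/= leey andbT integral_ge0// => x _; exact: poweR_ge0.
- by rewrite in_itv/= leey andbT integral_ge0// => x _; exact: poweR_ge0.
apply: ae_ge0_le_integral => //.
- by move=> x _; exact: poweR_ge0.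
- apply: (measurableT_comp (measurable_poweR p)).
  by apply: measurableT_comp => //; exact/measurable_EFinP.
- by move=> x _; exact: poweR_ge0.
- apply: (measurableT_comp (measurable_poweR p)).
  by apply: measurableT_comp => //; exact/measurable_EFinP.
apply: filterS uv => x uvx _; apply: gt0_ler_poweR; first exact: ltW.
- by rewrite in_itv/= leey andbT lee_fin.
- by rewrite in_itv/= leey andbT lee_fin.
- by rewrite lee_fin.
Qed.

Lemma normc_ge0 (z : R[i]) : 0 <= normc z.
Proof. by case: z => a b; exact: sqrtr_ge0. Qed.

Lemma measurable_normc f : cmeasurable f ->
  measurable_fun setT (@normc R \o f).
Proof.
move=> [mr mi].
rewrite (_ : _ \o _ =
    Num.sqrt \o (fun x => complex.Re (f x) ^+ 2 + complex.Im (f x) ^+ 2)); last first.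
  by apply/funext => x /=; case: (f x).
apply: measurableT_comp.
  by apply: continuous_measurable_fun => ?; exact: sqrt_continuous.
by apply: measurable_funD; exact: measurable_funX.
Qed.

Lemma cmeasurableD f g : cmeasurable f -> cmeasurable g -> cmeasurable (f + g).
Proof.
move=> [rf jf] [rg jg]; split.
- rewrite (_ : _ \o _ = (@complex.Re R \o f) \+ (@complex.Re R \o g)).
    exact: measurable_funD.
  by apply/funext => x /=; rewrite fctE; case: (f x); case: (g x).
- rewrite (_ : _ \o _ = (@complex.Im R \o f) \+ (@complex.Im R \o g)).
    exact: measurable_funD.
  by apply/funext => x /=; rewrite fctE; case: (f x); case: (g x).
Qed.

Lemma cmeasurableZ (a : R[i]) f : cmeasurable f -> cmeasurable (a *: f).
Proof.
move=> [rf jf]; split.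
- rewrite (_ : _ \o _ =
      (fun x => complex.Re a * complex.Re (f x)) \- (fun x => complex.Im a * complex.Im (f x))).
    by apply: measurable_funB; exact: measurable_funM.
  by apply/funext => x /=; rewrite fctE; case: a; case: (f x).
- rewrite (_ : _ \o _ =
      (fun x => complex.Re a * complex.Im (f x)) \+ (fun x => complex.Im a * complex.Re (f x))).
    by apply: measurable_funD; exact: measurable_funM.
  by apply/funext => x /=; rewrite fctE; case: a; case: (f x).
Qed.

Lemma cmeasurable0 : cmeasurable 0.
Proof. by split; exact: measurable_cst. Qed.

Lemma cLnorm_ge0 p f : (0 <= cLnorm p f)%E.
Proof. exact: Lnorm_ge0. Qed.

Lemma cLnorm0 p : 0 < p -> cLnorm p 0 = 0%E.
Proof.
move=> p0; rewrite -[RHS](Lnorm0 mu (p := p%:E)) ?eqe ?gt_eqF//.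
by apply: eq_Lnorm => x /=; rewrite -[LHS]/(normc (0 : R[i]))%:E normc0.
Qed.

Lemma cLnormD p f g : 1 <= p -> cmeasurable f -> cmeasurable g ->
  (cLnorm p (f + g)%R <= cLnorm p f + cLnorm p g)%E.
Proof.
move=> p1 mf mg; have p0 : 0 < p by exact: lt_le_trans p1.
apply: le_trans (minkowski_EFin mu (measurable_normc mf) (measurable_normc mg) p1).
apply: ae_le_Lnorm => //; first exact/measurable_normc/cmeasurableD.
  by apply: measurable_funD; exact: measurable_normc.
apply/nearW => x /=; rewrite !ger0_norm ?addr_ge0 ?normc_ge0//.
exact: le_normcD.
Qed.

Lemma cLnormZ p (a : R[i]) f : 0 < p -> cmeasurable f ->
  cLnorm p (a *: f)%R = ((normc a)%:E * cLnorm p f)%E.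
Proof.
move=> p0 mf; rewrite /cLnorm unlock /Lnorm.
under eq_integral => x _.
  rewrite -[(EFin \o _) x]/(normc (a * f x))%:E normcM EFinM abseM.
  rewrite poweRM ?abse_ge0// gee0_abs ?lee_fin ?normc_ge0//.
  rewrite poweR_EFin.
  over.
rewrite ge0_integralZl//; last 3 first.
- apply: (measurableT_comp (measurable_poweR p)).
  by apply: measurableT_comp => //; exact/measurable_EFinP/measurable_normc.
- by move=> x _; exact: poweR_ge0.
- by rewrite lee_fin powR_ge0.
rewrite poweRM ?lee_fin ?powR_ge0//; last first.
  by apply: integral_ge0 => x _; exact: poweR_ge0.
by rewrite poweR_EFin -powRrM mulfV ?gt_eqF// powRr1 ?normc_ge0.
Qed.

Lemma cLnorm_ae p f g : 0 < p -> cmeasurable f -> cmeasurable g ->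
  f = g %[ae mu] -> cLnorm p f = cLnorm p g.
Proof.
move=> p0 mf mg fg; apply/eqP; rewrite eq_le.
apply/andP; split; apply: ae_le_Lnorm => //; try exact: measurable_normc;
  by apply: filterS fg => x /(_ I) /= ->.
Qed.

Lemma cLnorm_eq0 p f : 0 < p -> cmeasurable f ->
  cLnorm p f = 0%E -> f = 0 %[ae mu].
Proof.
move=> p0 mf fn0.
have /measurable_EFinP mf' := measurable_normc mf.
have := Lnorm_eq0_eq0 mf' (_ : 0 < p%:E)%E fn0; rewrite lte_fin => /(_ p0).
by apply: filterS => x /(_ I) /= [] /eq0_normc.
Qed.

End complex_functions.

Section complex_Lspace.
Context d (T : measurableType d) (R : realType).
Variables (mu : {measure set T -> \bar R}) (p : R) (p1 : 1 <= p).

Let p0 : 0 < p. Proof. exact: lt_le_trans p1. Qed.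

(* [p1] is an argument of the predicate so that its closure properties can be
   inferred. *)
Definition cLfun_pred of 1 <= p : {pred (T -> R[i])} := mem (cLfun mu p).
Local Notation cLfunp := (cLfun_pred p1).

Lemma cLfun_predE f : (f \in cLfunp) = (f \in cLfun mu p).
Proof. by []. Qed.

Lemma cLfun_submod_closed : submod_closed cLfunp.
Proof.
split; first by rewrite cLfun_predE inE; split;
  [exact: cmeasurable0 | rewrite cLnorm0].
move=> a f g; rewrite !cLfun_predE !inE => -[mf lf] [mg lg].
have maf := cmeasurableZ a mf.
split; first exact: cmeasurableD.
apply: le_lt_trans (cLnormD _ _ _ _) _ => //.
by rewrite lte_add_pinfty// cLnormZ// lte_mul_pinfty// lee_fin normc_ge0.
Qed.

HB.instance Definition _ :=
  GRing.isSubmodClosed.Build _ _ cLfunp cLfun_submod_closed.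

Record cLfunType := CLfun { cLfun_val :> T -> R[i] ; _ : cLfun_val \in cLfunp }.

HB.instance Definition _ := [isSub for cLfun_val].
HB.instance Definition _ := [Choice of cLfunType by <:].
HB.instance Definition _ := [SubChoice_isSubLmodule of cLfunType by <:].

Lemma cLfunP (f : cLfunType) : cmeasurable f /\ (cLnorm mu p f < +oo)%E.
Proof. by have := valP f; rewrite cLfun_predE inE. Qed.

Lemma cLfun_valB (f g : cLfunType) x : (f - g) x = f x - g x.
Proof. by []. Qed.

Lemma cLfun_valD (f g : cLfunType) x : (f + g) x = f x + g x.
Proof. by []. Qed.

Lemma cLfun_valZ a (f : cLfunType) x : (a *: f) x = a * f x.
Proof. by []. Qed.

Definition cnull : {pred cLfunType} := mem [set f : cLfunType | f = 0 %[ae mu]].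

Lemma cnullE (f : cLfunType) : (f \in cnull) <-> f = 0 %[ae mu].
Proof. by rewrite inE. Qed.

Lemma cnull_zmod_closed : zmod_closed cnull.
Proof.
split; first by apply/cnullE; exact: nearW.
move=> f g /cnullE f0 /cnullE g0; apply/cnullE.
apply: filterS2 f0 g0 => x /(_ I) fx /(_ I) gx _.
by rewrite cLfun_valB fx gx subrr.
Qed.

HB.instance Definition _ := GRing.isZmodClosed.Build _ cnull cnull_zmod_closed.

(* The space L^p(T, mu) of complex functions, as the quotient of [cLfunType] by
   almost everywhere equality. *)
Definition cLspace : Type := Quotient.quot cnull.
HB.instance Definition _ := GRing.Zmodule.on cLspace.
HB.instance Definition _ := EqQuotient.on cLspace.

Definition cLspace_fun (u : cLspace) : cLfunType := repr u.
Coercion cLspace_fun : cLspace >-> cLfunType.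

Local Open Scope quotient_scope.
Definition cLclass (f : cLfunType) : cLspace := \pi f.
Local Notation pi := cLclass.

Lemma pi_ae (f g : cLfunType) : pi f = pi g <-> f = g %[ae mu].
Proof.
have E : pi f = pi g <-> f - g \in cnull.
  by split => [/eqP|H]; [rewrite -Quotient.idealrBE|apply/eqP; rewrite -Quotient.idealrBE].
rewrite E cnullE; split; apply: filterS => x /(_ I); rewrite cLfun_valB.
  by move/eqP; rewrite subr_eq0 => /eqP.
by move=> -> _; rewrite subrr.
Qed.

Lemma repr_ae (f : cLfunType) : pi f = f %[ae mu].
Proof. by apply/pi_ae; exact: reprK. Qed.

Lemma pi_cD (f g : cLfunType) : pi (f + g) = pi f + pi g.
Proof. exact: (Quotient.pi_add cnull). Qed.

Lemma pi_c0 : pi 0 = 0.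
Proof. by apply: (@addrI _ (pi 0)); rewrite -pi_cD !addr0. Qed.

Definition cscale (a : R[i]) (u : cLspace) : cLspace := pi (a *: (u : cLfunType)).

Lemma pi_cscale a (f : cLfunType) : cscale a (pi f) = pi (a *: f).
Proof.
apply/pi_ae; have := repr_ae f; apply: filterS => x /(_ I) E _.
by rewrite !cLfun_valZ E.
Qed.

Lemma cLclassK (u : cLspace) : cLclass u = u.
Proof. exact: reprK. Qed.

Fact cscaleA a b u : cscale a (cscale b u) = cscale (a * b) u.
Proof. by rewrite -[u]cLclassK !pi_cscale scalerA. Qed.

Fact cscale1 : left_id 1 cscale.
Proof. by move=> u; rewrite -[u]cLclassK pi_cscale scale1r. Qed.

Fact cscaleDr : right_distributive cscale +%R.
Proof.
move=> a u v; rewrite -[u]cLclassK -[v]cLclassK.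
by rewrite -pi_cD !pi_cscale scalerDr pi_cD.
Qed.

Fact cscaleDl u : {morph cscale^~ u : a b / a + b}.
Proof. by move=> a b; rewrite -[u]cLclassK !pi_cscale scalerDl pi_cD. Qed.

HB.instance Definition _ := GRing.Zmodule_isLmodule.Build R[i] cLspace
  cscaleA cscale1 cscaleDr cscaleDl.

Definition cLspace_norm (u : cLspace) : R[i] := (fine (cLnorm mu p u))%:C.

Lemma cLspace_norm_class (f : cLfunType) :
  cLspace_norm (cLclass f) = (fine (cLnorm mu p f))%:C.
Proof.
congr (fine _)%:C; apply: cLnorm_ae p0 _ _ (repr_ae f).
  exact: (cLfunP _).1.
exact: (cLfunP _).1.
Qed.

Lemma cLnorm_fin_num (f : cLfunType) : cLnorm mu p f \is a fin_num.
Proof. by rewrite ge0_fin_numE ?cLnorm_ge0//; exact: (cLfunP f).2. Qed.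

Fact cLspace_normD u v :
  cLspace_norm (u + v) <= cLspace_norm u + cLspace_norm v.
Proof.
rewrite -[u]cLclassK -[v]cLclassK -pi_cD !cLspace_norm_class -rmorphD lecR.
rewrite -lee_fin EFinD !fineK ?cLnorm_fin_num//.
by apply: cLnormD => //; exact: (cLfunP _).1.
Qed.

Fact cLspace_normZ a u : cLspace_norm (a *: u) = `|a| * cLspace_norm u.
Proof.
rewrite -[u]cLclassK -[_ *: _]/(cscale _ _) pi_cscale !cLspace_norm_class.
rewrite -[`|a|]/(normc a)%:C -rmorphM; congr (_)%:C.
by rewrite (cLnormZ mu a p0 (cLfunP _).1) fineM ?cLnorm_fin_num.
Qed.

Fact cLspace_norm0_eq0 u : cLspace_norm u = 0 -> u = 0.
Proof.
rewrite -[u]cLclassK cLspace_norm_class => -[/eqP].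
rewrite fine_eq0 ?cLnorm_fin_num// => /eqP.
by move=> /(cLnorm_eq0 p0 (cLfunP _).1) u0; rewrite -pi_c0; apply/pi_ae.
Qed.

HB.instance Definition _ := Lmodule_isNormed.Build R[i] cLspace
  cLspace_normD cLspace_normZ cLspace_norm0_eq0.

End complex_Lspace.

Section spectral_theory.
Context (R : realType) (V : normedModType R[i]).
Implicit Types (S T : {linear V -> V}) (l z : R[i]).

Definition opnorm_le (f : V -> V) (c : R) :=
  forall x, `|f x| <= c%:C * `|x|.

Definition bounded_op (f : V -> V) := exists c, opnorm_le f c.

Definition is_resolvent T z S :=
  [/\ bounded_op S, forall x, S (z *: x - T x) = x &
      forall x, z *: S x - T (S x) = x].

Definition resolvent_set T : set R[i] :=
  [set z | exists S, is_resolvent T z S].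

(* The resolvent z |-> (z - T)^-1 is defined on a punctured disc around l, where
   it is the sum in operator norm of a Laurent series
     (z - l)^(-m) A_0 + (z - l)^(1 - m) A_1 + ...  with m > 0 and A_0 != 0. *)
Definition resolvent_pole T l :=
  exists (m : nat) (A : nat -> {linear V -> V}) (r : R),
    [/\ (0 < m)%N, 0 < r, forall n, bounded_op (A n), exists x, A 0%N x != 0 &
      forall z, 0 < `|z - l| < r%:C -> exists2 S, is_resolvent T z S &
        forall e : R, 0 < e -> \forall N \near \oo,
          opnorm_le (fun x => S x -
            \sum_(n < N) (z - l) ^ (n%:Z - m%:Z) *: A n x) e].

Definition eigenvalue_op T l := exists2 x, x != 0 & T x = l *: x.

(* The algebraic multiplicity of l is the dimension of this subspace. *)
Definition generalized_eigenspace T l : set V :=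
  [set x | exists n, iter n (fun y => l *: y - T y) x = 0].

Definition finite_dimensional (W : set V) :=
  exists s : seq V, forall x, W x ->
    exists c : nat -> R[i], x = \sum_(i < size s) c i *: s`_i.

Definition finite_alg_multiplicity T l :=
  finite_dimensional (generalized_eigenspace T l).

Definition ess_radius_bound T : set R :=
  [set r | 0 <= r /\ forall l, r%:C < `|l| ->
    resolvent_set T l \/
    [/\ resolvent_pole T l, eigenvalue_op T l & finite_alg_multiplicity T l]].

(* The infimum is taken in the extended reals so that it is +oo, rather than a
   junk value, if there is no bound; otherwise it is a minimum. *)
Definition ess_spectral_radius T : \bar R :=
  ereal_inf [set r%:E | r in ess_radius_bound T].

Lemma ess_spectral_radius_min T : ess_radius_bound T !=set0 ->
  exists2 r, ess_radius_bound T r & ess_spectral_radius T = r%:E.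
Proof.
move=> [r0 br0]; pose E := [set r%:E | r in ess_radius_bound T].
have le_r0 : (ess_spectral_radius T <= r0%:E)%E.
  by apply: ereal_inf_lbound; exists r0.
have ge_0 : (0%:E <= ess_spectral_radius T)%E.
  by apply: le_ereal_inf_tmp => _ [r [r_ge0 _] <-]; rewrite lee_fin.
have fin : ess_spectral_radius T \is a fin_num.
  by rewrite ge0_fin_numE// (le_lt_trans le_r0) ?ltry.
exists (fine (ess_spectral_radius T)); last by rewrite fineK.
split; first exact: fine_ge0.
move=> l; rewrite -[`|l|]/(normc l)%:C ltcR -lte_fin fineK// => /ereal_inf_lt.
by case=> _ [r [_ br] <-]; rewrite lte_fin => rl; apply: br; rewrite ltcR.
Qed.

End spectral_theory.

(* T u is a class in L^p; it lies in L^q when its representative does, and its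
   L^q-norm does not depend on the representative ([cLnorm_ae]). *)
Definition hypercontractive d (Omega : measurableType d) (R : realType)
    (mu : probability Omega R) (p : R) (p1 : 1 <= p)
    (T : {linear cLspace mu p1 -> cLspace mu p1}) :=
  exists2 q : R, p < q & forall u : cLspace mu p1, let Tu : cLspace mu p1 := T u in
    cLfun mu q Tu /\ (cLnorm mu q Tu <= cLnorm mu p u)%E.

(* Main.v *)
Require Import Defs.
From HB Require Import structures.
From mathcomp Require Import all_boot all_order all_algebra complex ring lra.
From mathcomp Require Import all_classical all_reals all_analysis.
From mathcomp Require Import measurable_realfun.

(** The operator [T] maps L^p into L^q with [q > p] and norm at most 1, so on a
    probability space it is a contraction of L^p. The norms of L^p and L^q agree
    only on functions of constant modulus; quantitatively, when [T] almost preserves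
    the norm of [f], the modulus of [T f] is nearly constant off a small set
    ([near_constant_of_norms]). Now let [l] be a scalar with modulus close to 1 and
    let [f0], [f] be unit vectors with [T f0] close to [l f0] and [T f] close to
    [l f]. The combinations [f0 + f] and [f0 + i f] are approximate eigenvectors
    too, so [T f0], [T f], [T f0 + T f] and [T f0 + i T f] all have nearly constant
    modulus. By polarisation the product of [T f] with the conjugate of [T f0] is
    nearly a constant, of modulus about 1, and hence so is its integral
    ([correlation_lower_bound]). In other words, approximate eigenspaces are at most
    one-dimensional: [l - T] is bounded below up to one functional, with constants
    that are uniform for [l] in an annulus inside the unit circle
    ([hypercontractive_almost_injective]).

    The conclusion then holds for every contraction [T] of a Banach space with this
    property ([spectral_gap]). If [z] is a resolvent point near [l], a suitable
    operator of rank one makes [l - T] invertible ([rank_one_correction]), and how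
    near [z] has to be is determined by the constants alone. So the equation
    [l x - T x = y] reduces to a scalar equation: either [l] is in the resolvent set,
    or it is an eigenvalue with a one-dimensional eigenspace. A Jordan block at [l]
    would make the powers of [T] grow ([spectral_ascent_le1]); so the eigenvalue is a
    simple pole of the resolvent, with a rank-one residue
    ([discrete_of_rank_one_correction], [simple_pole]). Poles are limits of resolvent
    points, and one can therefore proceed from the exterior of the unit circle, where
    the resolvent is a Neumann series, through the whole annulus in steps of fixed
    length. Neumann series need the completeness of L^p ([Lspace_complete]). *)

Set Implicit Arguments.
Unset Strict Implicit.
Unset Printing Implicit Defensive.
Import Order.TTheory GRing.Theory Num.Theory numFieldNormedType.Exports.
Import Normc.
Local Open Scope classical_set_scope.
Local Open Scope complex_scope.
Local Open Scope ring_scope.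

(** * Real-valued norms *)

Section real_norm.
Context (R : realType) (V : normedModType R[i]).
Implicit Types (x y : V) (a b : R[i]).

Definition nrm x : R := complex.Re `|x|.

Lemma nrmE x : `|x| = (nrm x)%:C.
Proof.
have : (0 : R[i]) <= `|x| := normr_ge0 x.
by rewrite /nrm; case: `|x| => r i; rewrite lecE /= => /andP[/eqP -> _].
Qed.

Lemma nrm_ge0 x : 0 <= nrm x.
Proof. by rewrite -lecR -nrmE; exact: normr_ge0. Qed.

Lemma nrmD x y : nrm (x + y) <= nrm x + nrm y.
Proof. by rewrite -lecR rmorphD /= -!nrmE ler_normD. Qed.

Lemma nrmZ a x : nrm (a *: x) = normc a * nrm x.
Proof.
by apply: complexI; rewrite rmorphM /= -!nrmE normrZ -[`|a|]/(normc a)%:C.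
Qed.

Lemma nrmN x : nrm (- x) = nrm x.
Proof. by rewrite /nrm normrN. Qed.

Lemma nrmB x y : nrm (x - y) <= nrm x + nrm y.
Proof. by rewrite -(nrmN y) nrmD. Qed.

Lemma nrm_le_sub x y : nrm x <= nrm y + nrm (x - y).
Proof. by apply: le_trans (nrmD _ _); rewrite subrKC. Qed.

Lemma nrm0 : nrm (0 : V) = 0.
Proof. by rewrite /nrm normr0. Qed.

Lemma nrm_eq0 x : nrm x = 0 -> x = 0.
Proof. by move=> x0; apply/eqP; rewrite -normr_eq0 nrmE x0. Qed.

Lemma nrm_gt0 x : x != 0 -> 0 < nrm x.
Proof.
move=> x0; rewrite lt_neqAle nrm_ge0 andbT eq_sym.
by apply: contraNN x0 => /eqP/nrm_eq0 ->.
Qed.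

Lemma normc_real (r : R) : normc r%:C = `|r|.
Proof. by rewrite /normc /= expr0n addr0 sqrtr_sqr. Qed.

Lemma normcB a b : normc (a - b) <= normc a + normc b.
Proof. by rewrite -(normcN b) le_normcD. Qed.

Lemma normcX a n : normc (a ^+ n) = normc a ^+ n.
Proof. by elim: n => [|n IHn]; rewrite ?expr0 ?normc1// !exprS normcM IHn. Qed.

End real_norm.

(** * Inverses and Neumann series *)

Section inverses.
Context (R : realType) (V : normedModType R[i]).
Implicit Types (L K : V -> V) (c k : R).

(** For a normed space this is equivalent to completeness, and it is the form in
    which Neumann series use it. *)
Definition summable_series_converge := forall (u : nat -> V) (M : R),
  (forall n, \sum_(i < n) nrm (u i) <= M) ->
  exists y, forall e : R, 0 < e ->
    exists N, forall n, (N <= n)%N -> nrm (y - \sum_(i < n) u i) <= e.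

(** The constant bounds the norm of the inverse; it is tracked because the step
    length in [spectral_gap] must not depend on the point. *)
Definition invertible_with c L :=
  (forall x, nrm x <= c * nrm (L x)) /\ forall y, exists x, L x = y.

Lemma opnorm_leP L c : opnorm_le L c <-> forall x, nrm (L x) <= c * nrm x.
Proof. by split=> H x; have := H x; rewrite !nrmE -rmorphM lecR. Qed.

Lemma linear_of L : linear L -> exists S : {linear V -> V}, S = L :> (V -> V).
Proof.
move=> linL; pose m := GRing.isLinear.Build R[i] V V _ L linL.
pose S : {linear V -> V} := HB.pack L m.
by exists S.
Qed.

Lemma invertible_inverse c (L : {linear V -> V}) : invertible_with c L ->
  exists S : {linear V -> V}, [/\ forall y, L (S y) = y, forall x, S (L x) = x &
    forall y, nrm (S y) <= c * nrm y].
Proof.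
move=> [lbL surL].
have injL x y : L x = L y -> x = y.
  move=> xy; apply/eqP; rewrite -subr_eq0; apply/eqP/nrm_eq0/le_anti.
  by rewrite nrm_ge0 andbT (le_trans (lbL _))// linearB xy subrr nrm0 mulr0.
have [f fK] := choice surL.
have linf : linear f.
  by move=> a x y; apply: injL; rewrite linearP !fK.
have [S SE] := linear_of linf.
exists S; rewrite SE; split => //; first by move=> x; apply: injL; rewrite fK.
by move=> y; rewrite (le_trans (lbL _))// fK.
Qed.

(** Neumann series: the residual equation [L x = y] is solved repeatedly, each
    round shrinking what is left by the factor [t], and the corrections sum up. *)
Lemma invertible_perturb (complV : summable_series_converge) c k (b t : R)
    (L K : {linear V -> V}) : 0 <= c -> 0 <= k -> 0 <= b ->
  invertible_with c L -> (forall x, nrm (L x) <= b * nrm x) ->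
  (forall x, nrm (K x) <= k * nrm x) -> c * k <= t -> t < 1 ->
  invertible_with (c / (1 - t)) (L \+ K).
Proof.
move=> c0 k0 b0 invL bL kK ckt t1; have [lbL _] := invL.
have [S [LS _ bS]] := invertible_inverse invL.
have t0 : 0 <= t by rewrite (le_trans _ ckt)// mulr_ge0.
have t1' : 0 < 1 - t by rewrite subr_gt0.
split=> /= [x|y].
  have h1 : nrm (L x) <= nrm (L x + K x) + nrm (K x).
    by rewrite -(nrmN (K x)); apply: le_trans (nrmD _ _); rewrite addrK.
  have h2 : c * nrm (K x) <= t * nrm x.
    rewrite (le_trans (ler_wpM2l c0 (kK x)))// mulrA.
    by rewrite ler_wpM2r ?nrm_ge0.
  have h3 := ler_wpM2l c0 h1.
  rewrite mulrAC ler_pdivlMr//.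
  by have := lbL x; rewrite mulrDr in h3; lra.
pose r n := iter n (fun z => - K (S z)) y.
have br n : nrm (r n) <= t ^+ n * nrm y.
  elim: n => [|n IHn]; first by rewrite expr0 mul1r.
  rewrite /= nrmN (le_trans (kK _))// (le_trans (ler_wpM2l k0 (bS (r n))))//.
  rewrite mulrA [k * c]mulrC (le_trans (ler_wpM2r (nrm_ge0 _) ckt))//.
  by rewrite exprS -mulrA ler_wpM2l.
have sumt n : \sum_(i < n) t ^+ i <= (1 - t)^-1.
  suff -> : \sum_(i < n) t ^+ i = (1 - t ^+ n) / (1 - t).
    by rewrite ler_piMl ?invr_ge0 ?(ltW t1')// gerBl exprn_ge0.
  elim: n => [|n IHn]; first by rewrite big_ord0 expr0 subrr mul0r.
  rewrite big_ord_recr /= IHn exprS; field.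
  by rewrite gt_eqF.
have [|x xP] := complV (fun n => S (r n)) (c * ((1 - t)^-1 * nrm y)).
  move=> n; apply: (@le_trans _ _ (\sum_(i < n) c * (t ^+ i * nrm y))).
    by apply: ler_sum => i _; rewrite (le_trans (bS _))// ler_wpM2l.
  by rewrite -mulr_sumr ler_wpM2l// -mulr_suml ler_wpM2r ?nrm_ge0.
have resid n : L (\sum_(i < n) S (r i)) + K (\sum_(i < n) S (r i)) = y - r n.
  elim: n => [|n IHn]; first by rewrite big_ord0 !linear0 addr0 subrr.
  rewrite big_ord_recr /= !linearD /= addrACA IHn LS /=.
  by rewrite opprK addrA subrK.
exists x; apply/eqP; rewrite -subr_eq0; apply/eqP/nrm_eq0/le_anti.
rewrite nrm_ge0 andbT; apply/ler_addgt0Pr => e e0; rewrite add0r.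
pose M := b + k + nrm y + 1.
have M0 : 0 < M by rewrite ltr_wpDl// !addr_ge0// nrm_ge0.
have eM : 0 < e / M by rewrite divr_gt0.
have [N HN] := xP _ eM.
have tn1 : `|t| < 1 by rewrite ger0_norm.
have /cvgrPdist_le /(_ _ eM) [n2 _ Hn2] := cvg_expr tn1.
pose n := maxn N n2.
have := HN n (leq_maxl _ _); set s := \sum_(i < n) _ => xs.
have := Hn2 n (leq_maxr _ _); rewrite /= sub0r normrN ger0_norm ?exprn_ge0// => hn.
have -> : L x + K x - y = L (x - s) + K (x - s) - r n.
  by rewrite !linearB /= addrACA -opprD resid opprB -[RHS]addrA [r n - y + _]addrAC subrr add0r.
have h1 := bL (x - s); have h2 := kK (x - s); have h3 := br n.
have h4 := nrmB (L (x - s) + K (x - s)) (r n).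
have h5 := nrmD (L (x - s)) (K (x - s)).
have h6 : nrm (x - s) * (b + k) <= e / M * (b + k).
  by rewrite ler_wpM2r// addr_ge0.
have h7 : t ^+ n * nrm y <= e / M * nrm y by rewrite ler_wpM2r ?nrm_ge0.
have h8 : e / M * (b + k) + e / M * nrm y <= e.
  rewrite -mulrDr -[leRHS]mulr1 -mulrA ler_wpM2l ?(ltW e0)// mulrC ler_pdivrMr//.
  by rewrite mul1r /M; lra.
by lra.
Qed.

Lemma invertible_perturb_half (complV : summable_series_converge) c k (b : R)
    (L K : {linear V -> V}) : 0 <= c -> 0 <= k -> 0 <= b ->
  invertible_with c L -> (forall x, nrm (L x) <= b * nrm x) ->
  (forall x, nrm (K x) <= k * nrm x) -> c * k <= 2^-1 ->
  invertible_with (2 * c) (L \+ K).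
Proof.
move=> c0 k0 b0 invL bL kK ck.
have -> : 2 * c = c / (1 - 2^-1) by field.
by apply: invertible_perturb invL bL kK ck _ => //; lra.
Qed.

End inverses.

(** * Rank-one corrections *)

Section rank_one.
Context (R : realType) (V : normedModType R[i]).
Implicit Types (phi : {scalar V}) (w x y : V).

Definition rank_one phi w x : V := phi x *: w.

Fact rank_one_linear phi w : linear (rank_one phi w).
Proof. by move=> a x y; rewrite /rank_one linearP scalerDl scalerA. Qed.

HB.instance Definition _ phi w :=
  GRing.isLinear.Build R[i] V V *:%R (rank_one phi w) (rank_one_linear phi w).

(** For [y = L x + phi x *: w] the functional [chi = phi \o L^-1] satisfies
    [chi y = phi x * (1 + chi w)]. Take for [w] a vector of the unit ball at which
    [chi] is positive and at least half its norm [K]: then the last factor is at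
    least [1 + K / 2], whence [normc (phi x) <= 2 * nrm y]. The point of the
    lemma is that this constant does not involve [c], since the inverse of [L]
    blows up near the spectrum. *)
Lemma rank_one_correction c (m : R) (L : {linear V -> V}) phi : 0 <= c -> 0 <= m ->
  invertible_with c L -> (forall x, normc (phi x) <= m * nrm x) ->
  exists w, [/\ nrm w <= 1,
    forall x, normc (phi x) <= 2 * nrm (L x + phi x *: w) &
    forall y, exists x, L x + phi x *: w = y].
Proof.
move=> c0 m0 invL bphi; have [S [LS SL bS]] := invertible_inverse invL.
pose chi y := phi (S y).
have bchi y : normc (chi y) <= m * c * nrm y.
  by rewrite (le_trans (bphi _))// -mulrA ler_wpM2l.
pose A := [set r | exists2 y, nrm y <= 1 & r = normc (chi y)].
have hsA : has_sup A.
  split; first by exists (normc (chi 0)); exists 0; rewrite ?nrm0.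
  exists (m * c) => _ [y y1 ->]; rewrite (le_trans (bchi y))//.
  by rewrite ler_piMr ?mulr_ge0.
pose K := sup A.
have chiK y : normc (chi y) <= K * nrm y.
  have [->|y0] := eqVneq y 0.
    by rewrite /chi !linear0 normc0 nrm0 mulr0.
  have ny0 := nrm_gt0 y0.
  rewrite -ler_pdivrMr//.
  have : A (normc (chi ((nrm y)^-1%:C *: y))).
    exists ((nrm y)^-1%:C *: y) => //.
    by rewrite nrmZ normc_real ger0_norm ?invr_ge0 ?nrm_ge0// mulVf ?gt_eqF.
  move=> /(ub_le_sup hsA.2); apply: le_trans.
  rewrite /chi !linearZ /= normcM normc_real ger0_norm ?invr_ge0 ?nrm_ge0//.
  by rewrite mulrC.
have K0 : 0 <= K.
  have : A (normc (chi 0)) by exists 0; rewrite ?nrm0.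
  by move=> /(ub_le_sup hsA.2); apply: le_trans; exact: normc_ge0.
have phiE x : phi x = chi (L x) by rewrite /chi SL.
have [K00|Kn0] := eqVneq K 0.
  exists 0; rewrite nrm0; split=> // [x|y].
    rewrite scaler0 addr0 phiE (le_trans (chiK _))// K00 mul0r.
    by rewrite mulr_ge0 ?nrm_ge0.
  by exists (S y); rewrite scaler0 addr0 LS.
have Kp : 0 < K by rewrite lt_neqAle eq_sym Kn0.
have K2 : 0 < K / 2 by rewrite divr_gt0.
have [_ [y0 y01 ->] hy0] := sup_adherent K2 hsA.
rewrite -/K in hy0.
pose t := normc (chi y0).
have tK : K / 2 < t by rewrite /t; lra.
have t0 : 0 < t by rewrite (lt_trans K2).
(* The phase that makes chi positive at the rotated vector. *)
pose a : R[i] := t%:C / chi y0.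
have chiy0 : chi y0 != 0.
  by apply: contraTneq t0 => h; rewrite /t h normc0 ltxx.
have na : normc a = 1.
  by rewrite normcM normcV normc_real ger0_norm ?(ltW t0)// divff// gt_eqF.
pose w := a *: y0.
have chiw : chi w = t%:C.
  by rewrite /chi !linearZ /= -/(chi y0) /a mulrVK// unitfE.
have chiD x z : chi (x + z) = chi x + chi z by rewrite /chi !linearD.
have chiZ b x : chi (b *: x) = b * chi x by rewrite /chi !linearZ.
have n1t : normc (1 + t%:C) = 1 + t.
  by rewrite -[1]/(1%:C) -rmorphD normc_real ger0_norm// addr_ge0 ?ltW.
exists w; split; first by rewrite nrmZ na mul1r.
- move=> x; set y := L x + _.
  have : chi y = phi x * (1 + chi w) by rewrite /y chiD chiZ -phiE mulrDr mulr1.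
  move=> /(congr1 (@normc R)); rewrite normcM chiw n1t => E.
  have h := chiK y; rewrite E in h.
  have h1 : normc (phi x) * (1 + K / 2) <= normc (phi x) * (1 + t).
    by rewrite ler_wpM2l ?normc_ge0// lerD2l ltW.
  have h2 := normc_ge0 (phi x).
  rewrite -(ler_pM2l Kp); nra.
- move=> y; have n0 : 1 + chi w != 0.
    rewrite chiw; apply/eqP => /(congr1 (@normc R)); rewrite n1t normc0.
    by apply/eqP; rewrite gt_eqF// addr_gt0.
  pose s := chi y / (1 + chi w).
  exists (S (y - s *: w)).
  rewrite LS; have -> : phi (S (y - s *: w)) = s.
    rewrite -/(chi _) -scaleNr chiD chiZ /s.
    by field.
  by rewrite subrK.
Qed.

End rank_one.

(** * Resolvents *)

Section shifts.
Context (R : realType) (V : normedModType R[i]).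
Implicit Types (T L K : {linear V -> V}) (z : R[i]) (phi : {scalar V}) (w x y : V).

Definition spectral_shift T z : V -> V := (z \*: idfun) \- T.
HB.instance Definition _ T z := GRing.Linear.on (spectral_shift T z).

Lemma spectral_shiftE T z x : spectral_shift T z x = z *: x - T x.
Proof. by []. Qed.

Lemma spectral_shift_perturb T z z' x :
  spectral_shift T z' x = spectral_shift T z x + (z' - z) *: x.
Proof. by rewrite !spectral_shiftE scalerBl addrC -addrA [RHS]addrC addrA subrK. Qed.

Lemma resolvent_setP T z : resolvent_set T z <->
  exists2 c, 0 <= c & invertible_with c (spectral_shift T z).
Proof.
split=> [[S [[c /opnorm_leP Sc] SL LS]]|[c c0 inv]].
  exists `|c| => //; split=> [x|y]; last by exists (S y); exact: LS.
  rewrite -{1}(SL x) (le_trans (Sc _))// ler_wpM2r ?nrm_ge0//.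
  exact: ler_norm.
have [S [LS SL bS]] := invertible_inverse inv.
by exists S; split=> //; exists c; apply/opnorm_leP.
Qed.

(** Here [T] is a perturbation of [z] times the identity of relative size
    [1 / normc z]. *)
Lemma resolvent_outside (complV : summable_series_converge V) T z :
  (forall x, nrm (T x) <= nrm x) -> 1 < normc z -> resolvent_set T z.
Proof.
move=> contrT z1; apply/resolvent_setP.
have z0 : 0 < normc z by rewrite (lt_trans ltr01).
have zu : z != 0 by apply: contraTneq z0 => ->; rewrite normc0 ltxx.
have -> : spectral_shift T z = (z \*: idfun) \+ (\- T) by [].
exists ((normc z)^-1 / (1 - (normc z)^-1)).
  by rewrite divr_ge0 ?invr_ge0 ?(ltW z0)// subr_ge0 invf_le1// ltW.
apply: (@invertible_perturb _ _ complV _ 1 (normc z)) => //=.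
- by rewrite invr_ge0 ltW.
- exact: ltW.
- split=> /= [x|y]; first by rewrite nrmZ mulKf// gt_eqF.
  by exists (z^-1 *: y); rewrite scalerA divff// scale1r.
- by move=> x; rewrite nrmZ.
- by move=> x; rewrite nrmN mul1r.
- by rewrite mulr1.
- by rewrite invf_lt1.
Qed.

End shifts.

(** * Simple poles of the resolvent *)

Section simple_pole.
Context (R : realType) (V : normedModType R[i]).
Implicit Types (T L K N P G : {linear V -> V}) (z u : R[i]) (phi : {scalar V}) (w x y : V).

Lemma bounded_opP L : bounded_op L <-> exists2 b, 0 <= b & forall x, nrm (L x) <= b * nrm x.
Proof.
split=> [[b /opnorm_leP Lb]|[b _ Lb]]; last by exists b; apply/opnorm_leP.
exists `|b| => // x; rewrite (le_trans (Lb x))// ler_wpM2r ?nrm_ge0//.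
exact: ler_norm.
Qed.

(** The coefficients of [u^-1 P + G (1 + u G)^-1], the first one being that of
    [u^-1]. *)
Definition laurent P G n x : V :=
  if n is k.+1 then (-1) ^+ k *: iter k.+1 G x else P x.

Fact laurent_linear P G n : linear (laurent P G n).
Proof.
case: n => [|n] a x y; first exact: linearP.
rewrite /laurent; have -> : iter n.+1 G (a *: x + y) = a *: iter n.+1 G x + iter n.+1 G y.
  by elim: n.+1 => [//|k IHk]; rewrite !iterS IHk linearP.
by rewrite scalerDr !scalerA mulrC.
Qed.

HB.instance Definition _ P G n :=
  GRing.isLinear.Build R[i] V V *:%R (laurent P G n) (laurent_linear P G n).

(** The space is the direct sum of the range and the kernel of the projection [P];
    [N = spectral_shift T l] vanishes on the former and has the inverse [G] on the
    latter. So [(u + N)^-1 = u^-1 P + G (1 + u G)^-1] for small [u <> 0], and the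
    geometric series of the last factor gives the Laurent expansion. *)
Lemma simple_pole (complV : summable_series_converge V) T l P G :
  bounded_op P -> bounded_op G ->
  (forall x, spectral_shift T l (P x) = 0) -> (forall x, P (spectral_shift T l x) = 0) ->
  (forall x, spectral_shift T l (G x) = x - P x) ->
  (forall x, G (spectral_shift T l x) = x - P x) ->
  (forall x, P (G x) = 0) -> (forall x, G (P x) = 0) ->
  (exists x, P x != 0) -> resolvent_pole T l.
Proof.
move=> /bounded_opP[b b0 Pb] /bounded_opP[g g0 Gg] NP PN NG GN PG GP P0.
exists 1%N, (fun n => laurent P G n : {linear V -> V}), (2 * (g + 1))^-1.
have g1 : 0 < 2 * (g + 1) by lra.
have iterG k x : nrm (iter k G x) <= g ^+ k * nrm x.
  elim: k => [|k IHk]; first by rewrite mul1r.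
  by rewrite iterS (le_trans (Gg _))// exprS -mulrA ler_wpM2l.
split=> //; first by rewrite invr_gt0.
  case=> [|n]; apply/bounded_opP; first by exists b.
  exists (g ^+ n.+1); first exact: exprn_ge0.
  by move=> x /=; rewrite nrmZ normcX normcN normc1 expr1n mul1r -iterS.
move=> z /andP[]; set u := z - l => u0 ur.
have {}u0 : u != 0 by rewrite -normr_gt0.
have nu : normc u * g <= 2^-1.
  move: ur; rewrite -[`|u|]/(normc u)%:C ltcR => ur.
  have : normc u * (2 * (g + 1)) <= 1.
    by rewrite -ler_pdivlMr// div1r ltW.
  by have := normc_ge0 u; nra.
have [|H [LH HL Hb]] := @invertible_inverse _ _ (2 * 1) (idfun \+ (u \*: G)).
  apply: (@invertible_perturb_half _ _ complV 1 (normc u * g) 1) => //=.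
  - by rewrite mulr_ge0// normc_ge0.
  - by split=> [x|y]; [rewrite mul1r|exists y].
  - by move=> x; rewrite mul1r.
  - by move=> x; rewrite nrmZ -mulrA ler_wpM2l ?normc_ge0.
  - by rewrite mul1r.
rewrite /= in LH HL.
have PH x : P (H x) = P x.
  by rewrite -{2}(LH x) linearD linearZ /= PG scaler0 addr0.
have HP x : H (P x) = P x.
  by rewrite -{1}[P x]addr0 -{1}(scaler0 _ u) -(GP x) HL.
have GH x : G (H x) = H (G x).
  by rewrite -[LHS]HL; congr (H _); rewrite -[in RHS](LH x) linearD linearZ.
have zE x : z *: x - T x = spectral_shift T l x + u *: x by rewrite -spectral_shift_perturb.
clearbody u.
exists ((u^-1 \*: P) \+ (G \o H)).
  split=> /=.
  - exists (normc u^-1 * b + g * 2); apply/opnorm_leP => x /=.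
    rewrite (le_trans (nrmD _ _))// mulrDl lerD//.
      by rewrite nrmZ -mulrA ler_wpM2l ?normc_ge0.
    by rewrite (le_trans (Gg _))// -mulrA ler_wpM2l// (le_trans (Hb _))// mulr1.
  - move=> x; rewrite zE linearD PN add0r linearZ /= scalerA mulVf// scale1r.
    rewrite GH linearD GN linearZ /= addrAC linearB /= HL HP.
    by rewrite subrKC.
  - move=> x; rewrite zE linearD linearZ /= NP scaler0 add0r NG PH.
    by rewrite scalerDr scalerA divff// scale1r addrA subrK LH.
have iterLH k x : iter k G x = iter k G (H x) + u *: iter k.+1 G (H x).
  rewrite -[in LHS](LH x); elim: k => [//|k IHk].
  by rewrite iterS IHk linearD linearZ.
(* The remainder of the geometric series is known exactly. *)
have partial k x : u^-1 *: P x + G (H x) -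
    \sum_(n < k.+1) u ^ (n%:Z - 1%:Z) *: laurent P G n x = (- u) ^+ k *: iter k.+1 G (H x).
  elim: k => [|k IHk] /=.
    by rewrite big_ord_recl big_ord0 /= addr0 sub0r exprN1 expr0 scale1r addrAC subrr add0r.
  rewrite big_ord_recr /= opprD addrA IHk.
  rewrite intS addrAC subrr add0r -exprnP -iterS (iterLH k.+1 x) scalerA -exprMn mulrN1.
  by rewrite scalerDr opprD addrA subrr add0r scalerA exprSr mulrN scaleNr.
move=> e e0.
have h1 : `|2^-1 : R| < 1 by rewrite ger0_norm; lra.
have e1 : 0 < e / (2 * (g + 1)) by rewrite divr_gt0.
have /cvgrPdist_le /(_ _ e1) [M _ HM] := cvg_expr h1.
exists M.+1 => // -[//|k] /= Mk; apply/opnorm_leP => x /=.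
rewrite partial nrmZ normcX normcN.
have := HM k Mk; rewrite /= sub0r normrN ger0_norm ?exprn_ge0// => hk.
apply: (le_trans (ler_wpM2l _ (iterG k.+1 (H x)))); first by rewrite exprn_ge0 ?normc_ge0.
rewrite exprSr !mulrA -exprMn.
have h2 : (normc u * g) ^+ k <= e / (2 * (g + 1)).
  rewrite (le_trans _ hk)// lerXn2r// ?nnegrE// ?mulr_ge0 ?normc_ge0//.
have h3 : g * nrm (H x) <= 2 * (g + 1) * nrm x.
  have := Hb x; rewrite mulr1 => Hbx.
  rewrite (le_trans (ler_wpM2l g0 Hbx))// mulrA ler_wpM2r ?nrm_ge0//; lra.
rewrite -mulrA (le_trans (ler_pM _ _ h2 h3)) ?exprn_ge0 ?mulr_ge0 ?normc_ge0 ?nrm_ge0//.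
by rewrite mulrA divfK ?gt_eqF.
Qed.

End simple_pole.

(** * Contractions that are almost injective near the unit circle *)

Section spectral_gap.
Context (R : realType) (V : normedModType R[i]).
Implicit Types (T : {linear V -> V}) (z l : R[i]) (phi : {scalar V}) (w x y : V).

(** The alternative that the essential spectral radius requires of the points
    outside its disc. *)
Definition regular_or_discrete T l := resolvent_set T l \/
  [/\ resolvent_pole T l, eigenvalue_op T l & finite_alg_multiplicity T l].

(** [l - T] is bounded below up to a one-dimensional defect, as measured by a
    functional: approximate eigenspaces for [l] have dimension at most one. *)
Definition almost_injective c T l := exists phi, exists2 m, 0 <= m &
  (forall x, normc (phi x) <= m * nrm x) /\
  forall x, nrm x <= c * (nrm (spectral_shift T l x) + normc (phi x)).

Lemma regular_or_discrete_limit T l : regular_or_discrete T l ->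
  forall e : R, 0 < e -> exists2 z, resolvent_set T z & normc (z - l) < e.
Proof.
case=> [rl e e0|[[m [A [r [_ r0 _ _ Ar]]]] _ _] e e0].
  by exists l; rewrite // subrr normc0.
pose t := Num.min e r / 2.
have me : 0 < Num.min e r by rewrite lt_min e0.
have t0 : 0 < t by rewrite divr_gt0.
have te : t < Num.min e r by rewrite /t; lra.
have nt : normc (l + t%:C - l) = t by rewrite addrC addKr normc_real gtr0_norm.
exists (l + t%:C); last by rewrite nt (lt_le_trans te)// ge_min lexx.
have [|S Sres _] := Ar (l + t%:C); last by exists S.
rewrite -[`|_|]/(normc _)%:C nt !ltcR t0 (lt_le_trans te)//.
by rewrite ge_min lexx orbT.
Qed.

(** A contraction has no Jordan block [N e2 = e1], [N e1 = 0] at a point [l] near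
    the unit circle: subtracting a multiple of [e1] one may suppose [phi e2 = 0],
    so that [nrm e2 <= c * nrm e1], while the norm of
    [T^(n+1) e2 = l^(n+1) e2 - (n+1) l^n e1] would exceed that of [e2] for large
    [n]. *)
Lemma spectral_ascent_le1 c T l n : 0 <= c -> (forall x, nrm (T x) <= nrm x) ->
  almost_injective c T l -> normc l <= 1 ->
  2^-1 <= normc l ^+ n -> 4 * c < n.+1%:R ->
  forall x, spectral_shift T l (spectral_shift T l x) = 0 -> spectral_shift T l x = 0.
Proof.
move=> c0 contrT [phi [m m0 [bphi lb]]] l1 ln cn x.
set N := spectral_shift T l; set e1 := N x => Ne1.
have [phie1|phie1] := eqVneq (phi e1) 0.
  apply/nrm_eq0/le_anti; rewrite nrm_ge0 andbT (le_trans (lb _))//.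
  by rewrite -/N Ne1 phie1 nrm0 normc0 addr0 mulr0.
pose e2 := x - (phi x / phi e1) *: e1.
have Ne2 : N e2 = e1 by rewrite /e2 /N linearB linearZ /= -/N Ne1 scaler0 subr0.
have phie2 : phi e2 = 0 by rewrite /e2 linearB linearZ /= divfK// subrr.
have e2e1 : nrm e2 <= c * nrm e1.
  by have := lb e2; rewrite -/N Ne2 phie2 normc0 addr0.
have Te1 : T e1 = l *: e1.
  by apply/eqP; rewrite eq_sym -subr_eq0; apply/eqP; rewrite -Ne1.
have Te2 : T e2 = l *: e2 - e1 by rewrite -Ne2 /N spectral_shiftE; rewrite opprB addrC subrK.
have iterT k : iter k.+1 T e2 = l ^+ k.+1 *: e2 - (k.+1%:R * l ^+ k) *: e1.
  elim: k => [|k IHk]; first by rewrite /= Te2 expr1 mulr1 scale1r.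
  rewrite iterS IHk linearB !linearZ /= Te1 Te2 scalerBr !scalerA -exprSr !scalerN scalerA.
  rewrite -addrA -opprD -scalerDl; congr (_ - _ *: _).
  by rewrite -mulrA -exprSr -{1}[l ^+ k.+1]mul1r -mulrDl addrC natr1.
have iterT_le k : nrm (iter k T e2) <= nrm e2.
  by elim: k => [//|k IHk]; rewrite iterS (le_trans (contrT _)).
have h1 : nrm ((n.+1%:R * l ^+ n) *: e1) <= nrm (l ^+ n.+1 *: e2) + nrm (iter n.+1 T e2).
  by rewrite iterT (le_trans _ (nrmB _ _))// subKr.
have nl1 : normc l ^+ n.+1 <= 1 by rewrite exprn_ile1// normc_ge0.
have h2 : nrm (l ^+ n.+1 *: e2) <= nrm e2.
  by rewrite nrmZ normcX ler_piMl ?nrm_ge0.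
have h3 : nrm ((n.+1%:R * l ^+ n) *: e1) = n.+1%:R * (normc l ^+ n * nrm e1).
  rewrite nrmZ normcM normcX -mulrA; congr (_ * _).
  by rewrite -[n.+1%:R in LHS](rmorph_nat (real_complex R)) normc_real ger0_norm.
have h4 : 2^-1 * nrm e1 <= normc l ^+ n * nrm e1 by rewrite ler_wpM2r ?nrm_ge0.
have h5 := iterT_le n.+1.
have n0 : (0 : R) < n.+1%:R by rewrite ltr0n.
have h6 := ler_wpM2l (ltW n0) h4.
apply/nrm_eq0/le_anti; rewrite nrm_ge0 andbT.
have := nrm_ge0 e1.
by nra.
Qed.

(** Let [N = l - T], let [C] be the inverse of [N + phi w] and [e1 = C w]. Then
    [N x = y] amounts to [x = C y + phi x *: e1], which has exactly one solution
    unless [phi e1 = 1]. In that case [e1] spans the kernel of [N], and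
    [kap = phi (C e1)] is nonzero because [N (C e1) = e1 - kap *: w] would
    otherwise begin a Jordan block. Then [P x = (phi (C x) / kap) *: e1] is the
    projection onto the kernel that commutes with [N], and
    [G = (1 - P) C (1 - P)] inverts [N] on the kernel of [P]. *)
Lemma discrete_of_rank_one_correction (complV : summable_series_converge V) T l phi w k m :
  0 <= k -> 0 <= m -> (forall x, nrm (T x) <= nrm x) ->
  (forall x, normc (phi x) <= m * nrm x) ->
  invertible_with k (spectral_shift T l \+ rank_one phi w) ->
  (forall x, spectral_shift T l (spectral_shift T l x) = 0 -> spectral_shift T l x = 0) ->
  regular_or_discrete T l.
Proof.
move=> k0 m0 contrT bphi invB asc.
have [C [BC CB bC]] := invertible_inverse invB.
rewrite /= in BC CB.
pose N : {linear V -> V} := spectral_shift T l.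
have phiD x y : phi (x + y) = phi x + phi y by rewrite linearD.
have phiB x y : phi (x - y) = phi x - phi y by rewrite linearB.
have phiZ a x : phi (a *: x) = a * phi x by rewrite linearZ.
have CZ a x : C (a *: x) = a *: C x by rewrite linearZ.
have NC y : N (C y) = y - phi (C y) *: w by apply/eqP; rewrite eq_sym subr_eq BC.
have CN x : C (N x) = x - phi x *: C w.
  by apply/eqP; rewrite eq_sym subr_eq -linearZ -linearD CB.
set e1 := C w in CN *.
have [phie1|phie1] := eqVneq (phi e1) 1; last first.
  have d0 : 1 - phi e1 != 0 by rewrite subr_eq0 eq_sym.
  left; apply/resolvent_setP.
  pose S y := C y + (phi (C y) / (1 - phi e1)) *: e1.
  have SN x : S (N x) = x.
    rewrite /S CN phiB phiZ.
    have -> : phi x - phi x * phi e1 = phi x * (1 - phi e1) by ring.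
    by rewrite mulfK// subrK.
  have NS y : N (S y) = y.
    have Ne1 : N e1 = (1 - phi e1) *: w by rewrite NC scalerBl scale1r.
    rewrite /S linearD [N (_ *: _)]linearZ /= NC Ne1.
    by rewrite scalerA divfK// subrK.
  pose b := k + m * k / normc (1 - phi e1) * nrm e1.
  have b0 : 0 <= b.
    by rewrite addr_ge0// mulr_ge0 ?nrm_ge0// divr_ge0 ?normc_ge0// mulr_ge0.
  exists b => //; split=> [x|y]; last by exists (S y); exact: NS.
  rewrite -{1}(SN x) /S (le_trans (nrmD _ _))// mulrDl lerD//.
  rewrite nrmZ mulrAC ler_wpM2r ?nrm_ge0// normcM normcV mulrAC.
  rewrite ler_wpM2r ?invr_ge0 ?normc_ge0//.
  by rewrite (le_trans (bphi _))// -mulrA ler_wpM2l.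
right.
have e10 : e1 != 0.
  by apply/eqP => h; move: phie1; rewrite h linear0 => /eqP; rewrite eq_sym oner_eq0.
have Ne1 : N e1 = 0 by rewrite NC phie1 scale1r subrr.
have Ce10 : phi (C e1) != 0.
  apply: contra e10 => /eqP h; apply/eqP; rewrite -[e1](_ : N (C e1) = _).
    by apply: asc; rewrite -/N NC h scale0r subr0.
  by rewrite NC h scale0r subr0.
set kap := phi (C e1) in Ce10.
have kerN x : N x = 0 -> x = phi x *: e1.
  by move=> Nx; have := CN x; rewrite Nx linear0 => /eqP; rewrite eq_sym subr_eq0 => /eqP.
pose psi x := phi (C x) / kap.
pose Pf x := psi x *: e1.
have linP : linear Pf.
  by move=> a x y; rewrite /Pf /psi !linearP mulrDl scalerDl -mulrA scalerA.
have [P PE'] := linear_of linP.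
have PE x : P x = psi x *: e1 by rewrite PE'.
have bP : bounded_op P.
  apply/bounded_opP; exists (m * k / normc kap * nrm e1).
    by rewrite mulr_ge0 ?nrm_ge0// divr_ge0 ?normc_ge0// mulr_ge0.
  move=> x; rewrite PE nrmZ mulrAC ler_wpM2r ?nrm_ge0// normcM normcV mulrAC.
  rewrite ler_wpM2r ?invr_ge0 ?normc_ge0//.
  by rewrite (le_trans (bphi _))// -mulrA ler_wpM2l.
have psiN x : psi (N x) = 0 by rewrite /psi CN phiB phiZ phie1 mulr1 subrr mul0r.
have psie1 : psi e1 = 1 by rewrite /psi divff.
have psiD x y : psi (x + y) = psi x + psi y by rewrite /psi linearD phiD mulrDl.
have psiZ a x : psi (a *: x) = a * psi x by rewrite /psi CZ phiZ mulrA.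
have psiP x : psi (P x) = psi x by rewrite PE psiZ psie1 mulr1.
have NP x : N (P x) = 0 by rewrite PE linearZ /= -/N Ne1 scaler0.
have PN x : P (N x) = 0 by rewrite PE psiN scale0r.
have PP x : P (P x) = P x by rewrite !PE psiZ psie1 mulr1.
have Pe1 : P e1 = e1 by rewrite PE psie1 scale1r.
pose Q : {linear V -> V} := idfun \- P.
have QE x : Q x = x - P x by [].
have PQ x : P (Q x) = 0 by rewrite QE linearB PP subrr.
have NQ x : N (Q x) = N x by rewrite QE linearB -/N NP subr0.
have phiCQ x : phi (C (Q x)) = 0.
  have : psi (Q x) = 0.
    by rewrite QE psiD -scaleN1r psiZ psiP mulN1r subrr.
  by rewrite /psi => /eqP; rewrite mulf_eq0 invr_eq0 (negPf Ce10) orbF => /eqP.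
have bQ : bounded_op Q.
  have /bounded_opP[b b0 Pb] := bP; apply/bounded_opP.
  exists (1 + b); first by rewrite addr_ge0.
  by move=> x; rewrite QE (le_trans (nrmB _ _))// mulrDl mul1r lerD2l.
pose G : {linear V -> V} := Q \o C \o Q.
split.
- apply: (@simple_pole _ _ complV T l P G) => //; rewrite -?/N.
  + have /bounded_opP[b b0 Qb] := bQ; apply/bounded_opP.
    exists (b * (k * b)); first by rewrite !mulr_ge0.
    move=> x; rewrite -mulrA (le_trans (Qb _))// ler_wpM2l// -mulrA.
    by rewrite (le_trans (bC _))// ler_wpM2l.
  + by move=> x; rewrite -/N /G /= NQ NC phiCQ scale0r subr0.
  + move=> x; rewrite -[LHS]/(Q (C (Q (N x)))) [Q (N x)]QE PN subr0 CN -scaleNr.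
    by rewrite !QE linearD linearZ /= Pe1 opprD addrACA subrr addr0.
  + by move=> x; rewrite /G /= PQ.
  + by move=> x; rewrite -[LHS]/(Q (C (Q (P x)))) [Q (P x)]QE PP subrr !linear0.
  + by exists e1; rewrite Pe1.
- by exists e1 => //; apply/eqP; rewrite eq_sym -subr_eq0; apply/eqP; rewrite -[RHS]Ne1.
- exists [:: e1] => x [n].
  suff gen j y : iter j (fun y => l *: y - T y) y = 0 -> y = phi y *: e1.
    move=> /gen xe; exists (fun _ => phi x).
    by rewrite big_ord_recl big_ord0 addr0.
  elim: j y => [y /= ->|j IHj y]; first by rewrite linear0 scale0r.
  rewrite iterSr -[_ - _]/(N y) => /IHj Ny.
  apply: kerN; rewrite Ny; have := PN y; rewrite {1}Ny linearZ /= Pe1 => ->.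
  by [].
Qed.

(** The admissible distance from [l] to a resolvent point [z] depends on [c] only.
    Indeed [T] is almost injective at [z] with [2 * c], so by [rank_one_correction] the
    corrected operator at [z] has an inverse bounded by [10 * c], and moving from
    [z] to [l] perturbs it by a number of modulus at most [(20 * c)^-1]. *)
Lemma regular_or_discrete_near (complV : summable_series_converge V) c T z l : 0 < c ->
  (forall x, nrm (T x) <= nrm x) -> almost_injective c T l ->
  (forall x, spectral_shift T l (spectral_shift T l x) = 0 -> spectral_shift T l x = 0) ->
  resolvent_set T z -> normc (l - z) <= (20 * c)^-1 ->
  regular_or_discrete T l.
Proof.
move=> c0 contrT [phi [m m0 [bphi lb]]] asc rz zl.
have [k k0 invz] := (resolvent_setP T z).1 rz.
have lzx x : nrm (spectral_shift T l x) <= nrm (spectral_shift T z x) + (20 * c)^-1 * nrm x.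
  rewrite (spectral_shift_perturb T z l) (le_trans (nrmD _ _))// lerD2l nrmZ.
  by rewrite ler_wpM2r ?nrm_ge0.
have c20 : c * (20 * c)^-1 = 20^-1 by field; rewrite gt_eqF.
have lbz x : nrm x <= 2 * c * (nrm (spectral_shift T z x) + normc (phi x)).
  have h1 := ler_wpM2l (ltW c0) (lzx x).
  have := lb x; rewrite mulrDr in h1 *; rewrite mulrA c20 in h1.
  rewrite mulrDr; have := nrm_ge0 x; lra.
have [w [w1 phiw surw]] := rank_one_correction k0 m0 invz bphi.
pose A : {linear V -> V} := spectral_shift T z \+ rank_one phi w.
have AE x : A x = spectral_shift T z x + phi x *: w by [].
have invA : invertible_with (10 * c) A.
  split=> // x; rewrite (le_trans (lbz x))//.
  have h1 := phiw x; rewrite -AE in h1.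
  have h2 : nrm (spectral_shift T z x) <= nrm (A x) + normc (phi x).
    rewrite -[spectral_shift T z x](addrK (phi x *: w)) -AE (le_trans (nrmB _ _))//.
    by rewrite lerD2l nrmZ ler_piMr ?normc_ge0.
  have -> : 10 * c * nrm (A x) = 2 * c * (5 * nrm (A x)) by ring.
  by rewrite ler_wpM2l ?mulr_ge0 ?(ltW c0)//; lra.
have bA x : nrm (A x) <= (normc z + 1 + m) * nrm x.
  rewrite AE (le_trans (nrmD _ _))// mulrDl lerD//.
    rewrite spectral_shiftE (le_trans (nrmB _ _))// mulrDl nrmZ mul1r.
    by rewrite lerD2l.
  by rewrite nrmZ (le_trans _ (bphi x))// ler_piMr ?normc_ge0.
have small : 10 * c * normc (l - z) <= 2^-1.
  rewrite (le_trans (ler_wpM2l _ zl)) ?mulr_ge0 ?(ltW c0)//.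
  by rewrite -mulrA c20; lra.
have invB : invertible_with (2 * (10 * c)) (A \+ ((l - z) \*: idfun)).
  apply: (invertible_perturb_half complV _ (normc_ge0 _) _ invA bA _ small).
  - by rewrite mulr_ge0// ltW.
  - by rewrite !addr_ge0 ?normc_ge0.
  - by move=> x; rewrite nrmZ.
apply: (discrete_of_rank_one_correction (w := w) complV _ m0 contrT bphi _ asc); last first.
  rewrite (_ : _ \+ _ = A \+ ((l - z) \*: idfun)); first exact: invB.
  by apply/funext => x /=; rewrite (spectral_shift_perturb T z l) addrAC.
by rewrite !mulr_ge0// ltW.
Qed.

Lemma bernoulli_lower (d : R) n : 0 <= d <= 1 -> 1 - n%:R * d <= (1 - d) ^+ n.
Proof.
move=> /andP[d0 d1]; elim: n => [|n IHn]; first by rewrite mul0r subr0.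
have h : (1 - d) * (1 - n%:R * d) <= (1 - d) ^+ n.+1.
  by rewrite exprS ler_wpM2l// subr_ge0.
apply: le_trans h; rewrite -natr1.
have : 0 <= n%:R * d * d by rewrite !mulr_ge0.
nra.
Qed.

(** Resolvent points lie arbitrarily near every point that has been treated,
    since poles are isolated, so [regular_or_discrete_near] carries the property
    from larger to smaller moduli in steps of fixed length [(40 * c)^-1], starting
    outside the unit disc. The width [d] of the annulus is such that
    [normc l ^+ n >= 1 / 2] with [n] as in [spectral_ascent_le1]. *)
Theorem spectral_gap (complV : summable_series_converge V) c (e : R) T :
  0 < c -> 0 < e -> (forall x, nrm (T x) <= nrm x) ->
  (forall l, 1 - e <= normc l <= 1 -> almost_injective c T l) ->
  exists2 r, r < 1 & ess_radius_bound T r.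
Proof.
move=> c0 e0 contrT aiT.
have [n cn] : exists n, 4 * c < n.+1%:R.
  have h : 0 <= 4 * c by rewrite mulr_ge0// ltW.
  exists (Num.bound (4 * c)); rewrite (lt_trans (archi_boundP h))// ltr_nat.
  exact: ltnSn.
pose d := Num.min e (Num.min (2^-1) (2 * n.+1%:R)^-1).
have n0 : 0 < 2 * n.+1%:R :> R by rewrite mulr_gt0.
have d0 : 0 < d by rewrite !lt_min e0 /= !invr_gt0 n0 ltr0n.
have de : d <= e by rewrite ge_min lexx.
have d2 : d <= 2^-1 by rewrite !ge_min lexx !orbT.
have dn : d <= (2 * n.+1%:R)^-1 by rewrite !ge_min lexx !orbT.
exists (1 - d); first lra.
split; first lra.
suff Zk k l : 1 - k%:R * (40 * c)^-1 < normc l -> 1 - d < normc l -> regular_or_discrete T l.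
  move=> l; rewrite -[`|l|]/(normc l)%:C ltcR => ld.
  have c40 : 0 < 40 * c by rewrite mulr_gt0.
  apply: (Zk (Num.bound (40 * c))) => //.
  have : 1 <= (Num.bound (40 * c))%:R * (40 * c)^-1.
    by rewrite ler_pdivlMr// mul1r ltW// archi_boundP// ltW.
  lra.
have s0 : 0 < (40 * c)^-1 by rewrite invr_gt0 mulr_gt0.
elim: k l => [|k IHk] l lk ld.
  by left; apply: resolvent_outside => //; move: lk; rewrite mul0r subr0.
have [l1|l1] := ltP 1 (normc l).
  by left; apply: resolvent_outside.
have l0 : 0 < normc l by lra.
have lu : l != 0 by apply: contraTneq l0 => ->; rewrite normc0 ltxx.
pose s := (40 * c)^-1.
have sE : (20 * c)^-1 = 2 * s by rewrite /s; field; rewrite gt_eqF.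
have ai : almost_injective c T l by apply: aiT; rewrite l1 andbT; lra.
have ln : 2^-1 <= normc l ^+ n.
  have h1 : (1 - d) ^+ n <= normc l ^+ n.
    by rewrite lerXn2r// ?nnegrE ?(ltW l0)//; lra.
  apply: le_trans h1; apply: (le_trans _ (bernoulli_lower _ _)); last lra.
  have h2 : n%:R * d <= n.+1%:R * (2 * n.+1%:R)^-1.
    by rewrite ler_pM ?ler_nat// ltW.
  have h3 : n.+1%:R * (2 * n.+1%:R)^-1 = 2^-1 :> R.
    by field; rewrite -[_ + _]/(1 + n%:R) ?nat1r pnatr_eq0.
  by rewrite h3 in h2; lra.
have asc := spectral_ascent_le1 (ltW c0) contrT ai l1 ln cn.
rewrite -/s in s0 lk IHk.
(* Three half steps outwards along the ray through l lies a treated point, and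
   within another half step of it a resolvent point. *)
pose a := 3 / 2 * s / normc l.
have a0 : 0 <= a by rewrite divr_ge0 ?(ltW l0)// mulr_ge0// ltW.
have al : a * normc l = 3 / 2 * s by rewrite divfK// gt_eqF.
have nl2 : normc (l + a%:C * l) = normc l + 3 / 2 * s.
  rewrite -{1}[l]mul1r -mulrDl -[1](rmorph1 (real_complex R)) -rmorphD normcM.
  by rewrite normc_real ger0_norm ?addr_ge0// mulrDl mul1r al.
have rd : regular_or_discrete T (l + a%:C * l).
  apply: IHk; rewrite nl2; last lra.
  by rewrite -natr1 in lk; lra.
have s2 : 0 < s / 2 by rewrite divr_gt0.
have [z rz zl2] := regular_or_discrete_limit rd s2.
apply: (regular_or_discrete_near complV c0 contrT ai asc rz).
rewrite sE; have -> : l - z = - (z - (l + a%:C * l)) - a%:C * l by ring.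
rewrite (le_trans (normcB _ _))// normcN normcM normc_real ger0_norm// al.
lra.
Qed.

End spectral_gap.

(** * Norms on a probability space *)

(** Young's inequality with one factor equal to 1: the convex power [s / r] lies
    above its tangent at 1. *)
Lemma powR_le_affine (R : realType) (t r s : R) : 0 <= t -> 0 < r -> r <= s ->
  t `^ r <= 1 - r / s + r / s * t `^ s.
Proof.
move=> t0 r0; rewrite le_eqVlt => /predU1P[<-|rs].
  by rewrite divff ?gt_eqF// subrr add0r mul1r.
have s0 := lt_trans r0 rs.
have rsn : 1 - r / s != 0 by rewrite gt_eqF// subr_gt0 ltr_pdivrMr// mul1r.
have := @conjugate_powR R (t `^ r) 1 (s / r) (1 - r / s)^-1.
rewrite powR_ge0 ler01 mulr1 powR1 -powRrM mulrCA divff ?gt_eqF// mulr1.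
rewrite invf_div invrK mul1r => h; apply: (le_trans (h _ _ _ _ _)) => //.
- by rewrite divr_gt0.
- by rewrite invr_gt0 subr_gt0 ltr_pdivrMr// mul1r.
- by rewrite addrC subrK.
- by rewrite addrC lerD2l mulrC.
Qed.

Section integrals.
Context d (T : measurableType d) (R : realType) (mu : {measure set T -> \bar R}).
Implicit Types (p q b : R) (f g : T -> R[i]) (h : T -> R).

Lemma measurable_powRf h p : measurable_fun setT h ->
  measurable_fun setT (fun x => h x `^ p).
Proof. by move=> mh; apply: (measurableT_comp (measurable_powR p) mh). Qed.

Lemma cLnorm_scaled p b f : 0 < p -> 0 < b -> cmeasurable f ->
  (\int[mu]_x ((normc (f x) / b) `^ p)%:E = (b `^ (- p))%:E * cLnorm mu p f `^ p)%E.
Proof.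
move=> p0 b0 mf; rewrite /cLnorm poweR_Lnorm ?gt_eqF//.
under [in RHS]eq_integral => x _ do
  rewrite /= ger0_norm ?normc_ge0//.
rewrite -ge0_integralZl_EFin ?powR_ge0//; last 2 first.
- by move=> x _; rewrite lee_fin powR_ge0.
- exact/measurable_EFinP/measurable_powRf/measurable_normc.
apply: eq_integral => x _; rewrite -EFinM; congr _%:E.
rewrite powRM ?normc_ge0 ?invr_ge0 ?(ltW b0)//.
by rewrite -powR_inv1 ?(ltW b0)// -powRrM mulN1r mulrC.
Qed.

(** Norm bounds are used after normalisation, as bounds by 1 of integrals of
    powers. *)
Lemma cLnorm_leP p b f : 0 < p -> 0 < b -> cmeasurable f ->
  (cLnorm mu p f <= b%:E)%E <-> (\int[mu]_x ((normc (f x) / b) `^ p)%:E <= 1)%E.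
Proof.
move=> p0 b0 mf; rewrite cLnorm_scaled//.
have bp0 : 0 < b `^ p by rewrite powR_gt0.
have -> : ((b `^ (- p))%:E * cLnorm mu p f `^ p <= 1)%E =
    (cLnorm mu p f `^ p <= (b `^ p)%:E)%E.
  by rewrite powRN lee_pdivrMl// mule1.
split=> H.
  rewrite -poweR_EFin; apply: gt0_ler_poweR => //; first exact: ltW.
    by rewrite in_itv/= leey andbT cLnorm_ge0.
  by rewrite in_itv/= leey andbT lee_fin ltW.
have cE : cLnorm mu p f = (cLnorm mu p f `^ p `^ p^-1)%E.
  by rewrite -poweRrM divff ?gt_eqF// poweRe1// cLnorm_ge0.
rewrite cE; have -> : b%:E = ((b `^ p)%:E `^ p^-1)%E.
  by rewrite poweR_EFin -powRrM divff ?gt_eqF// powRr1// ltW.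
apply: gt0_ler_poweR => //; first by rewrite invr_ge0 ltW.
  by rewrite in_itv/= leey andbT poweR_ge0.
by rewrite in_itv/= leey andbT lee_fin ltW.
Qed.

Lemma cLnorm_ge_integral p a b f : 0 < p -> 0 < b -> 0 <= a -> cmeasurable f ->
  (a%:E <= cLnorm mu p f)%E ->
  (((a / b) `^ p)%:E <= \int[mu]_x ((normc (f x) / b) `^ p)%:E)%E.
Proof.
move=> p0 b0 a0 mf af; rewrite cLnorm_scaled//.
have -> : ((a / b) `^ p)%:E = ((b `^ (- p))%:E * a%:E `^ p)%E.
  rewrite poweR_EFin -EFinM; congr _%:E.
  rewrite powRM ?invr_ge0 ?(ltW b0)//.
  by rewrite -powR_inv1 ?(ltW b0)// -powRrM mulN1r mulrC.
apply: lee_pmul => //; rewrite ?lee_fin ?powR_ge0 ?poweR_ge0//.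
apply: gt0_ler_poweR => //; first exact: ltW.
  by rewrite in_itv/= leey andbT lee_fin.
by rewrite in_itv/= leey andbT cLnorm_ge0.
Qed.

End integrals.

Section probability_norms.
Context d (T : measurableType d) (R : realType) (mu : probability T R).
Implicit Types (p q r s b : R) (f g : T -> R[i]) (h : T -> R).

Lemma integral_powR_le1 h r s : 0 < r -> r <= s -> measurable_fun setT h ->
  (forall x, 0 <= h x) ->
  (\int[mu]_x (h x `^ s)%:E <= 1)%E -> (\int[mu]_x (h x `^ r)%:E <= 1)%E.
Proof.
move=> r0 rs mh h0 hs; have s0 := lt_le_trans r0 rs.
have rs1 : r / s <= 1 by rewrite ler_pdivrMr// mul1r.
have rs0 : 0 <= r / s by rewrite divr_ge0 ?ltW.
apply: (@le_trans _ _ (\int[mu]_x ((1 - r / s)%:E + (r / s)%:E * (h x `^ s)%:E)))%E.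
  apply: ge0_le_integral => //.
  - by move=> x _; rewrite lee_fin powR_ge0.
  - exact/measurable_EFinP/measurable_powRf.
  - apply: emeasurable_funD => //; apply: emeasurable_funM => //.
    exact/measurable_EFinP/measurable_powRf.
  - by move=> x _; rewrite -EFinM -EFinD lee_fin powR_le_affine.
rewrite ge0_integralD//; last 3 first.
- by move=> x _; rewrite lee_fin subr_ge0.
- by move=> x _; rewrite -EFinM lee_fin mulr_ge0// powR_ge0.
- apply: emeasurable_funM => //; exact/measurable_EFinP/measurable_powRf.
rewrite integral_cst//.
rewrite [X in ((1 - r / s)%:E * X)%E](_ : _ = 1%E) ?mule1; last exact: probability_setT.
rewrite ge0_integralZl_EFin//; last 2 first.
- by move=> x _; rewrite lee_fin powR_ge0.
- exact/measurable_EFinP/measurable_powRf.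
apply: (@le_trans _ _ ((1 - r / s)%:E + (r / s)%:E * 1))%E.
  by rewrite leeD2l// lee_pmul2l// lte_fin divr_gt0.
by rewrite mule1 -EFinD subrK.
Qed.

Lemma cLnorm_homo r s f : 0 < r -> r <= s -> cmeasurable f ->
  (cLnorm mu r f <= cLnorm mu s f)%E.
Proof.
move=> r0 rs mf; have s0 := lt_le_trans r0 rs.
have [->|] := eqVneq (cLnorm mu s f) +oo%E; first by rewrite leey.
rewrite -ltey => fin; have fn : cLnorm mu s f \is a fin_num.
  by rewrite ge0_fin_numE ?cLnorm_ge0.
rewrite -(fineK fn); set b := fine _.
have b0 : 0 <= b by rewrite fine_ge0// cLnorm_ge0.
apply/lee_addgt0Pr => e e0; rewrite -EFinD.
have be : 0 < b + e by rewrite ltr_wpDl.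
apply/cLnorm_leP => //; apply: (integral_powR_le1 r0 rs).
- by apply: measurable_funM => //; exact: measurable_normc.
- by move=> x; rewrite divr_ge0 ?normc_ge0// ltW.
- by apply/cLnorm_leP => //; rewrite -(fineK fn) lee_fin lerDl ltW.
Qed.

End probability_norms.

(** * Functions whose norms nearly agree have nearly constant modulus *)

(** Bernoulli's inequality with a quadratic gain: the difference of the two sides
    without the square, [n v^(n+1) - (n+1) v^n + 1], is [(v - 1)^2] times the sum
    of the [k v^(k-1)] for [1 <= k <= n], which is at least 1. *)
Lemma sqrB1_le_bernoulli (R : realType) (v : R) n : (0 < n)%N -> 0 <= v ->
  (v - 1) ^+ 2 + n.+1%:R * v ^+ n <= n%:R * v ^+ n.+1 + 1.
Proof.
case: n => // n _ v0; elim: n => [|n IHn]; first by rewrite expr1; lra.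
have h : 0 <= n.+2%:R * v ^+ n.+1 * (v - 1) ^+ 2.
  by rewrite mulr_ge0 ?sqr_ge0 ?mulr_ge0 ?exprn_ge0.
have -> : n.+3%:R = n.+1%:R + 2 :> R by rewrite -[n.+3%:R]natr1 -[n.+2%:R]natr1; ring.
have E : n.+2%:R = n.+1%:R + 1 :> R by rewrite -natr1.
rewrite E in h IHn *.
rewrite !exprS in h IHn *; nra.
Qed.

Section near_constant.
Context d (T : measurableType d) (R : realType) (mu : probability T R).
Implicit Types (p q r s b : R) (f g : T -> R[i]) (h : T -> R).

Lemma chebyshev_ge0 h (a : R) : measurable_fun setT h -> (forall x, 0 <= h x) -> 0 < a ->
  (a%:E * mu [set x | (a <= h x)%R] <= \int[mu]_x (h x)%:E)%E.
Proof.
move=> mh h0 a0.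
have mh' : measurable_fun setT (EFin \o h) by exact/measurable_EFinP.
have := @le_integral_comp_abse _ _ _ mu setT measurableT (EFin \o h) a id
  (@measurable_id _ _ setT) (fun _ H => H) (fun _ _ _ _ H => H) mh' a0.
rewrite setTI (_ : [set x | _] = [set x | (a <= h x)%R]); last first.
  by apply/seteqP; split=> x /=; rewrite lee_fin ger0_norm.
by under eq_integral => x _ do rewrite /= ger0_norm//.
Qed.

Lemma measurable_ge h (a : R) : measurable_fun setT h -> measurable [set x | a <= h x].
Proof.
move=> mh; rewrite -[X in measurable X]setTI.
rewrite (_ : [set x | _] = h @^-1` `[a, +oo[); first exact: mh.
by apply/seteqP; split=> x /=; rewrite in_itv /= andbT.
Qed.

(** With [v = h^(p/n)] and [n] so large that [p (n+1) / n <= q], the integral of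
    [v^n = h^p] is almost 1 and that of [v^(n+1)] at most 1. So
    [sqrB1_le_bernoulli] makes the integral of [(v - 1)^2] small, and Chebyshev's
    inequality applies. *)
Lemma near_one_of_norms p q (eta : R) : 0 < p -> p < q -> 0 < eta ->
  exists2 e : R, 0 < e < 1 & forall h, measurable_fun setT h -> (forall x, 0 <= h x) ->
    (\int[mu]_x (h x `^ q)%:E <= 1)%E ->
    (((1 - e) `^ p)%:E <= \int[mu]_x (h x `^ p)%:E)%E ->
    (mu [set x | (eta <= `|h x - 1|)%R] <= eta%:E)%E.
Proof.
move=> p0 pq eta0; have q0 := lt_trans p0 pq.
have qp : 0 < q - p by rewrite subr_gt0.
pose n := Num.bound (p / (q - p)).
have pn : p / (q - p) < n%:R by rewrite archi_boundP// divr_ge0// ltW.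
have n0 : 0 < n%:R :> R by rewrite (lt_trans _ pn)// divr_gt0.
have n0' : (0 < n)%N by rewrite ltr0n in n0.
pose al := p / n%:R; have al0 : 0 < al by rewrite divr_gt0.
have q1 : al * n.+1%:R <= q.
  rewrite /al mulrAC ler_pdivrMr// -natr1; rewrite ltr_pdivrMr// in pn; nra.
pose lo := Num.max 0 (1 - eta).
have lo0 : 0 <= lo by rewrite le_max lexx.
have lo1 : lo < 1 by rewrite gt_max ltr01; lra.
(* The distance from 1 that h^al keeps when h is eta away from 1. *)
pose kap := Num.min ((1 + eta) `^ al - 1) (1 - lo `^ al).
have kap0 : 0 < kap.
  have one : 1 `^ al = 1 by rewrite powR1.
  rewrite lt_min !subr_gt0; apply/andP.
  split; [rewrite -[ltLHS]one|rewrite -[ltRHS]one].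
    by apply: gt0_ltr_powR; rewrite ?nnegrE//; lra.
  by apply: gt0_ltr_powR; rewrite ?nnegrE.
have kapP t : 0 <= t -> eta <= `|t - 1| -> kap ^+ 2 <= (t `^ al - 1) ^+ 2.
  move=> t0 h; rewrite -[leRHS]real_normK ?num_real// lerXn2r ?nnegrE ?(ltW kap0)//.
  have [t1|t1] := leP 1 t.
    rewrite ger0_norm ?subr_ge0// in h.
    have : (1 + eta) `^ al <= t `^ al.
      by apply: ge0_ler_powR; rewrite ?nnegrE ?(ltW al0)//; lra.
    move=> h'; rewrite (le_trans _ (ler_norm _))// ge_min lerD2r h'//.
  rewrite ltr0_norm ?subr_lt0// opprB in h.
  have : t `^ al <= lo `^ al.
    apply: ge0_ler_powR; rewrite ?nnegrE ?(ltW al0)//.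
    by rewrite le_max; apply/orP; right; lra.
  move=> h'; rewrite distrC (le_trans _ (ler_norm _))// ge_min.
  by rewrite lerD2l lerN2 h' orbT.
pose m := Num.bound p.
have pm : p < m%:R by rewrite archi_boundP// ltW.
have m0 : 0 < m%:R :> R := lt_trans p0 pm.
have nm0 : 0 < n.+1%:R * m%:R :> R by rewrite mulr_gt0// ltr0n.
pose e := Num.min 2^-1 (kap ^+ 2 * eta / (n.+1%:R * m%:R)).
have e0 : 0 < e by rewrite lt_min invr_gt0 ltr0n /= divr_gt0 ?mulr_gt0// exprn_gt0.
have e2 : e <= 2^-1 by rewrite ge_min lexx.
exists e; first by apply/andP; split => //; lra.
move=> h mh h0 hq hp.
pose v x := h x `^ al.
have v0 x : 0 <= v x by exact: powR_ge0.
have vX k x : v x ^+ k = h x `^ (al * k%:R) by rewrite -powR_mulrn// -powRrM.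
have mv : measurable_fun setT v by exact: measurable_powRf.
have mvX k : measurable_fun setT (fun x => v x ^+ k) by exact: measurable_funX.
have vn : (\int[mu]_x (v x ^+ n)%:E = \int[mu]_x (h x `^ p)%:E)%E.
  by apply: eq_integral => x _; rewrite vX /al divfK ?gt_eqF.
have vn1 : (\int[mu]_x (v x ^+ n.+1)%:E <= 1)%E.
  under eq_integral => x _ do rewrite vX.
  by apply: (integral_powR_le1 _ q1 mh h0 hq); rewrite mulr_gt0.
have mv2 : measurable_fun setT (fun x => (v x - 1) ^+ 2).
  by apply: measurable_funX; exact: measurable_funB.
have key : (\int[mu]_x ((v x - 1) ^+ 2)%:E + n.+1%:R%:E * \int[mu]_x (v x ^+ n)%:E <= n.+1%:R%:E)%E.
  apply: (@le_trans _ _ (\int[mu]_x (n%:R * v x ^+ n.+1 + 1)%:E)%E).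
    rewrite -ge0_integralZl_EFin//; last 2 first.
    - by move=> x _; rewrite lee_fin exprn_ge0.
    - exact/measurable_EFinP.
    rewrite -ge0_integralD//; last 4 first.
    - by move=> x _; rewrite lee_fin sqr_ge0.
    - exact/measurable_EFinP.
    - by move=> x _; rewrite -EFinM lee_fin mulr_ge0// exprn_ge0.
    - by apply: emeasurable_funM => //; exact/measurable_EFinP.
    apply: ge0_le_integral => //.
    - by move=> x _; rewrite -EFinM -EFinD lee_fin addr_ge0 ?sqr_ge0// mulr_ge0// exprn_ge0.
    - by apply: emeasurable_funD; [|apply: emeasurable_funM => //]; exact/measurable_EFinP.
    - by apply/measurable_EFinP; apply: measurable_funD => //; exact: measurable_funM.
    - by move=> x _; rewrite -EFinM -EFinD lee_fin sqrB1_le_bernoulli.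
  under eq_integral => x _ do rewrite EFinD EFinM.
  rewrite ge0_integralD//; last 2 first.
  - by move=> x _; rewrite -EFinM lee_fin mulr_ge0// exprn_ge0.
  - by apply: emeasurable_funM => //; exact/measurable_EFinP.
  rewrite ge0_integralZl_EFin//; last 2 first.
  - by move=> x _; rewrite lee_fin exprn_ge0.
  - exact/measurable_EFinP.
  rewrite integral_cst// [X in (_ + 1 * X)%E](_ : _ = 1%E) ?mule1; last exact: probability_setT.
  rewrite -natr1 EFinD leeD2r// -[leRHS]mule1 lee_pmul2l//.
have cheb := @chebyshev_ge0 (fun x => (v x - 1) ^+ 2) (kap ^+ 2) mv2 (fun x => sqr_ge0 _)
  (exprn_gt0 _ kap0).
have sub : (mu [set x | (eta <= `|h x - 1|)%R] <= mu [set x | (kap ^+ 2 <= (v x - 1) ^+ 2)%R])%E.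
  apply: le_measure; rewrite ?inE.
  - apply: measurable_ge; apply: measurableT_comp => //; exact: measurable_funB.
  - exact: measurable_ge.
  - by move=> x /= hx; exact: kapP.
have A : 1 - m%:R * e <= (1 - e) `^ p.
  have h1 : (1 - e) `^ m%:R <= (1 - e) `^ p.
    by apply: ger_powR; [apply/andP; split; lra|exact: ltW].
  apply: le_trans h1; rewrite powR_mulrn; last lra.
  by apply: bernoulli_lower; apply/andP; split; lra.
set I := (\int[mu]_x ((v x - 1) ^+ 2)%:E)%E in cheb key.
have Ik : (I <= (kap ^+ 2 * eta)%:E)%E.
  have h1 : (I + (n.+1%:R * (1 - m%:R * e))%:E <= n.+1%:R%:E)%E.
    apply: le_trans key; rewrite leeD2l// EFinM lee_pmul2l ?lte_fin ?ltr0n//.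
    by rewrite vn (le_trans _ hp)// lee_fin.
  rewrite -leeBrDr// -EFinB in h1; apply: (le_trans h1); rewrite lee_fin.
  have -> : n.+1%:R - n.+1%:R * (1 - m%:R * e) = (n.+1%:R * m%:R) * e by ring.
  by rewrite mulrC -ler_pdivlMr// ge_min lexx orbT.
have k20 : 0 < kap ^+ 2 by rewrite exprn_gt0.
have := le_trans cheb Ik; rewrite [X in (_ <= X)%E](EFinM (kap ^+ 2)) lee_pmul2l//; exact: le_trans.
Qed.

End near_constant.

Section complex_near_constant.
Context d (T : measurableType d) (R : realType) (mu : probability T R).
Implicit Types (p q r s b : R) (f g : T -> R[i]) (h : T -> R).

Lemma integral_normcE f : cmeasurable f ->
  (\int[mu]_x (normc (f x))%:E = cLnorm mu 1 f)%E.
Proof.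
move=> mf; rewrite /cLnorm Lnorm1; apply: eq_integral => x _ /=.
by rewrite ger0_norm ?normc_ge0.
Qed.

(** The case of [near_one_of_norms] after division by [b]. The bound [e] has to be
    uniform in [b], so small [b] are set apart: there Chebyshev's inequality
    already shows that the function is small. *)
Lemma near_constant_of_norms p q (eta : R) : 1 <= p -> p < q -> 0 < eta <= 1 ->
  exists2 e : R, 0 < e & forall f b, cmeasurable f -> 0 <= b <= 2 ->
    (cLnorm mu q f <= b%:E)%E -> ((b - e)%:E <= cLnorm mu p f)%E ->
    (mu [set x | (eta <= `|normc (f x) - b|)%R] <= eta%:E)%E.
Proof.
move=> p1 pq /andP[eta0 eta1].
have p0 : 0 < p by rewrite (lt_le_trans ltr01).
have q0 := lt_trans p0 pq; have q1 : 1 <= q by rewrite (le_trans p1)// ltW.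
have eta20 : 0 < eta / 2 by rewrite divr_gt0.
have [e1 /andP[e10 e11] He1] := near_one_of_norms mu p0 pq eta20.
pose b0 := eta ^+ 2 / 2; have b00 : 0 < b0 by rewrite divr_gt0// exprn_gt0.
exists (e1 * b0); first by rewrite mulr_gt0.
move=> f b mf /andP[bge0 b2] fq fp.
have mn := measurable_normc mf.
have mb : measurable_fun setT (fun x => `|normc (f x) - b|).
  by apply: measurableT_comp => //; exact: measurable_funB.
have [bb0|bb0] := leP b b0.
  apply: (@le_trans _ _ (mu [set x | (eta <= normc (f x))%R])).
    apply: le_measure; rewrite ?inE; [exact: measurable_ge|exact: measurable_ge|].
    move=> x /=; have := normc_ge0 (f x); have : b < eta by rewrite /b0 in bb0; nra.
    by move=> b_eta n0; rewrite ler_normr => /orP[|]; lra.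
  have := chebyshev_ge0 mu mn (fun x => normc_ge0 _) eta0.
  rewrite integral_normcE// => h.
  have h1 : (eta%:E * mu [set x | (eta <= normc (f x))%R] <= (eta * eta)%:E)%E.
    rewrite (le_trans h)// (le_trans (cLnorm_homo mu ltr01 q1 mf))// (le_trans fq)//.
    by rewrite lee_fin -expr2 (le_trans bb0)// /b0; have := sqr_ge0 eta; lra.
  by rewrite EFinM lee_pmul2l in h1.
have bgt0 : 0 < b by rewrite (lt_trans b00).
have mfb : measurable_fun setT (fun x => normc (f x) / b).
  exact: measurable_funM.
have fb0 x : 0 <= normc (f x) / b by rewrite divr_ge0// normc_ge0.
have be0 : 0 <= b - e1 * b0.
  by rewrite subr_ge0 (le_trans _ (ltW bb0))// ler_piMl ?ltW.
have := He1 _ mfb fb0 ((cLnorm_leP mu q0 bgt0 mf).1 fq).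
have h1 : (((1 - e1) `^ p)%:E <= \int[mu]_x ((normc (f x) / b) `^ p)%:E)%E.
  apply: le_trans (cLnorm_ge_integral p0 bgt0 be0 mf fp).
  rewrite lee_fin; apply: ge0_ler_powR; rewrite ?nnegrE ?divr_ge0 ?(ltW p0) ?(ltW bgt0)//.
    by rewrite subr_ge0 ltW.
  by rewrite ler_pdivlMr// mulrBl mul1r lerD2l lerN2 ler_wpM2l ?ltW.
move=> /(_ h1) h2.
apply: (@le_trans _ _ (eta / 2)%:E); last by rewrite lee_fin; lra.
apply: le_trans h2; apply: le_measure; rewrite ?inE.
- exact: measurable_ge.
- apply: measurable_ge; apply: measurableT_comp => //.
  exact: measurable_funB.
- move=> x /= hx.
  have -> : normc (f x) / b - 1 = (normc (f x) - b) / b.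
    by rewrite mulrBl divff// gt_eqF.
  rewrite normrM normfV (ger0_norm bge0) ler_pdivlMr// (le_trans _ hx)//.
  by nra.
Qed.

End complex_near_constant.

(** * Polarisation *)

Section correlation.
Context d (T : measurableType d) (R : realType) (mu : probability T R).
Implicit Types (f g : T -> R[i]) (F : T -> R).

Lemma sqr_normcE (z : R[i]) : normc z ^+ 2 = complex.Re z ^+ 2 + complex.Im z ^+ 2.
Proof. by case: z => a b; rewrite /normc sqr_sqrtr// addr_ge0 ?sqr_ge0. Qed.

Lemma Re_le_normc (z : R[i]) : `|complex.Re z| <= normc z.
Proof.
rewrite -(ler_pXn2r (n := 2)) ?nnegrE ?normc_ge0// sqr_normcE.
by rewrite real_normK ?num_real// lerDl sqr_ge0.
Qed.

Lemma Im_le_normc (z : R[i]) : `|complex.Im z| <= normc z.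
Proof.
rewrite -(ler_pXn2r (n := 2)) ?nnegrE ?normc_ge0// sqr_normcE.
by rewrite real_normK ?num_real// lerDr sqr_ge0.
Qed.

(** The squared moduli of [x + y] and [x + iy] exceed [normc x ^+ 2 + normc y ^+ 2]
    by [2 * Re c] and [- 2 * Im c] respectively, where [c = y * x^*]. *)
Lemma polarisation_approx (x y : R[i]) (a b : R) :
  0 <= a <= 2 -> 0 <= b <= 2 ->
  `|normc x - 1| <= 100^-1 -> `|normc y - 1| <= 100^-1 ->
  `|normc (x + y) - a| <= 100^-1 -> `|normc (x + 'i%C * y) - b| <= 100^-1 ->
  `|complex.Re (y * x^*) - (a ^+ 2 / 2 - 1)| <= 6 / 100 /\
  `|complex.Im (y * x^*) - (1 - b ^+ 2 / 2)| <= 6 / 100.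
Proof.
move=> /andP[a0 a2] /andP[b0 b2].
have := normc_ge0 (x + y); have := normc_ge0 (x + 'i%C * y).
have := normc_ge0 x; have := normc_ge0 y.
have := sqr_normcE (x + y); have := sqr_normcE (x + 'i%C * y).
have := sqr_normcE x; have := sqr_normcE y.
move: (normc (x + y)) (normc (x + 'i%C * y)) (normc x) (normc y) => s t nx ny.
case: x => x1 x2; case: y => y1 y2 /=.
rewrite ?mul0r ?mul1r ?sub0r ?add0r ?opprK ?mulrN ?mulNr ?opprK ?addr0.
move=> Ey Ex Et Es ny0 nx0 t0 s0.
rewrite !ler_norml => /andP[h1 h2] /andP[h3 h4] /andP[h5 h6] /andP[h7 h8].
split; apply/andP; split; nra.
Qed.
End correlation.

(** * Integrals of complex functions *)

Section complex_integral.
Context d (T : measurableType d) (R : realType) (mu : probability T R).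
Implicit Types (f g k : T -> R[i]) (F G : T -> R) (a : R[i]).

Lemma cmeasurableM f g : cmeasurable f -> cmeasurable g ->
  cmeasurable (fun x => f x * g x).
Proof.
move=> [rf jf] [rg jg]; split.
- rewrite (_ : _ \o _ = (fun x => complex.Re (f x) * complex.Re (g x)) \-
      (fun x => complex.Im (f x) * complex.Im (g x))).
    by apply: measurable_funB; exact: measurable_funM.
  by apply/funext => x /=; case: (f x); case: (g x).
- rewrite (_ : _ \o _ = (fun x => complex.Re (f x) * complex.Im (g x)) \+
      (fun x => complex.Im (f x) * complex.Re (g x))).
    by apply: measurable_funD; exact: measurable_funM.
  by apply/funext => x /=; case: (f x); case: (g x).
Qed.

Lemma integrable_normc f : cmeasurable f -> (cLnorm mu 1 f < +oo)%E ->
  mu.-integrable setT (EFin \o (@normc R \o f)).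
Proof.
move=> mf fin; apply/integrableP; split; first exact/measurable_EFinP/measurable_normc.
rewrite (le_lt_trans _ fin)// -integral_normcE//.
by under eq_integral => x _ do rewrite /= ger0_norm ?normc_ge0//.
Qed.

Lemma integrable_le_normc f F : cmeasurable f -> (cLnorm mu 1 f < +oo)%E ->
  measurable_fun setT F -> (forall x, `|F x| <= normc (f x)) ->
  mu.-integrable setT (EFin \o F).
Proof.
move=> mf fin mF Ff; apply: le_integrable (integrable_normc mf fin) => //.
  exact/measurable_EFinP.
by move=> x _ /=; rewrite lee_fin (le_trans (Ff x))// ler_norm.
Qed.

Lemma integrable_EFinZ (c : R) F : mu.-integrable setT (EFin \o F) ->
  mu.-integrable setT (EFin \o (fun x => c * F x)).
Proof. by move=> iF; exact: (integrableZl measurableT c iF). Qed.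

Lemma integrable_EFinD F G : mu.-integrable setT (EFin \o F) ->
  mu.-integrable setT (EFin \o G) -> mu.-integrable setT (EFin \o (fun x => F x + G x)).
Proof. by move=> iF iG; exact: (integrableD measurableT iF iG). Qed.

Lemma integrable_EFinB F G : mu.-integrable setT (EFin \o F) ->
  mu.-integrable setT (EFin \o G) -> mu.-integrable setT (EFin \o (fun x => F x - G x)).
Proof. by move=> iF iG; exact: (integrableB measurableT iF iG). Qed.

Definition cint f : R[i] :=
  (\int[mu]_x complex.Re (f x)) +i* (\int[mu]_x complex.Im (f x)).

Lemma cint_ae f g : cmeasurable f -> cmeasurable g -> f = g %[ae mu] -> cint f = cint g.
Proof.
move=> [rf jf] [rg jg] fg; rewrite /cint /Rintegral; congr (fine _ +i* fine _).
  apply: ae_eq_integral => //; try exact/measurable_EFinP.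
  by apply: filterS fg => x /(_ I) -> _.
apply: ae_eq_integral => //; try exact/measurable_EFinP.
by apply: filterS fg => x /(_ I) -> _.
Qed.

Lemma cint_linear a f g : cmeasurable f -> (cLnorm mu 1 f < +oo)%E ->
  cmeasurable g -> (cLnorm mu 1 g < +oo)%E ->
  cint (fun x => a * f x + g x) = a * cint f + cint g.
Proof.
move=> mf ff mg fg.
have rf := integrable_le_normc mf ff mf.1 (fun x => Re_le_normc _).
have jf := integrable_le_normc mf ff mf.2 (fun x => Im_le_normc _).
have rg := integrable_le_normc mg fg mg.1 (fun x => Re_le_normc _).
have jg := integrable_le_normc mg fg mg.2 (fun x => Im_le_normc _).
case: a => a1 a2; rewrite /cint.
have -> : \int[mu]_x complex.Re ((a1 +i* a2) * f x + g x) =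
    \int[mu]_x ((a1 * complex.Re (f x) - a2 * complex.Im (f x)) + complex.Re (g x)).
  by apply: eq_Rintegral => x _; case: (f x) => ? ?; case: (g x).
have -> : \int[mu]_x complex.Im ((a1 +i* a2) * f x + g x) =
    \int[mu]_x ((a1 * complex.Im (f x) + a2 * complex.Re (f x)) + complex.Im (g x)).
  by apply: eq_Rintegral => x _; case: (f x) => ? ?; case: (g x).
rewrite RintegralD//; last by apply: integrable_EFinB; exact: integrable_EFinZ.
rewrite RintegralB ?RintegralZl//; [|exact: integrable_EFinZ|exact: integrable_EFinZ].
rewrite RintegralD//; last by apply: integrable_EFinD; exact: integrable_EFinZ.
by rewrite RintegralD ?RintegralZl//; exact: integrable_EFinZ.
Qed.

Lemma normc_le_ReIm (z : R[i]) : normc z <= `|complex.Re z| + `|complex.Im z|.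
Proof.
rewrite -(ler_pXn2r (n := 2)) ?nnegrE ?normc_ge0 ?addr_ge0// sqr_normcE.
rewrite -(real_normK (num_real (complex.Re z))) -(real_normK (num_real (complex.Im z))).
by have := normr_ge0 (complex.Re z); have := normr_ge0 (complex.Im z); nra.
Qed.

Lemma normc_cint_le f : cmeasurable f -> (cLnorm mu 1 f < +oo)%E ->
  normc (cint f) <= 2 * fine (cLnorm mu 1 f).
Proof.
move=> mf ff; rewrite (le_trans (normc_le_ReIm _))//= mulr2n mulrDl mul1r.
have nf := integrable_normc mf ff.
have rf := integrable_le_normc mf ff mf.1 (fun x => Re_le_normc _).
have jf := integrable_le_normc mf ff mf.2 (fun x => Im_le_normc _).
have E : fine (cLnorm mu 1 f) = \int[mu]_x normc (f x) by rewrite -integral_normcE.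
rewrite E lerD// (le_trans (le_normr_Rintegral _ _))//; apply: le_Rintegral => //.
- exact: integrable_norm.
- by move=> x _; exact: Re_le_normc.
- exact: integrable_norm.
- by move=> x _; exact: Im_le_normc.
Qed.

(** On the bad set [F] is only controlled by [g], but little of [g] lives there:
    the modulus of [g] has integral at most 1 and is at least 99/100 elsewhere. *)
Lemma Rintegral_near g F (A : R) (bad : set T) : cmeasurable g ->
  (cLnorm mu 1 g <= 1)%E -> measurable_fun setT F -> measurable bad ->
  (mu bad <= (4 / 100)%:E)%E -> (forall x, `|F x| <= 101 / 100 * normc (g x)) ->
  `|A| <= 1 ->
  (forall x, ~ bad x -> `|F x - A| <= 6 / 100 /\ 99 / 100 <= normc (g x)) ->
  `|\int[mu]_x F x - A| <= 16 / 100.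
Proof.
move=> mg g1 mF mbad mubad Fg A1 good.
have gfin : (cLnorm mu 1 g < +oo)%E by rewrite (le_lt_trans g1)// ltry.
have ig := integrable_normc mg gfin.
have icst (c : R) : mu.-integrable setT (EFin \o (cst c : T -> R)).
  exact: finite_measure_integrable_cst.
have i1 : mu.-integrable setT (EFin \o (\1_bad : T -> R)).
  exact: integrable_indic.
have iF : mu.-integrable setT (EFin \o F).
  apply: le_integrable (integrable_EFinZ (101 / 100) ig) => //; first exact/measurable_EFinP.
  by move=> x _ /=; rewrite lee_fin (le_trans (Fg x))// ler_norm.
have muT : fine (mu setT) = 1 by rewrite probability_setT.
have -> : \int[mu]_x F x - A = \int[mu]_x (F x - A).
  rewrite RintegralB//; last exact: icst.
  by rewrite Rintegral_cst// muT mulr1.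
rewrite (le_trans (le_normr_Rintegral _ _))//; first exact: integrable_EFinB (icst A).
(* On the good set the first and last terms of K add up to at least 6/100; on the
   bad set the middle term absorbs A and the negative constant. *)
pose K x := (101 / 100 * normc (g x) + (21 / 10) * \1_bad x) + (6 / 100 - 9999 / 10000).
apply: (@le_trans _ _ (\int[mu]_x K x)).
  apply: le_Rintegral => //.
  - by apply: integrable_norm; exact: integrable_EFinB (icst A).
  - by apply: integrable_EFinD (icst _); apply: integrable_EFinD; exact: integrable_EFinZ.
  - move=> x _; rewrite /K indicE; have [xb|xb] := boolP (x \in bad).
      rewrite (le_trans (ler_normB _ _))// (le_trans (lerD (Fg x) A1))//=; lra.
    have [h1 h2] := good x (fun h => negP xb (mem_set h)).
    by rewrite (le_trans h1)//=; lra.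
rewrite /K RintegralD//; last 2 first.
- by apply: integrable_EFinD; exact: integrable_EFinZ.
- exact: icst.
rewrite RintegralD//; [|exact: integrable_EFinZ|exact: integrable_EFinZ].
rewrite !RintegralZl// Rintegral_cst// muT mulr1.
have h1 : \int[mu]_x normc (g x) <= 1.
  by rewrite /Rintegral integral_normcE// -lee_fin fineK// ge0_fin_numE ?cLnorm_ge0.
have h2 : \int[mu]_x (\1_bad x : R) <= 4 / 100.
  rewrite /Rintegral integral_indic// setIT -lee_fin fineK//.
  exact: fin_num_measure.
lra.
Qed.

End complex_integral.

(** * Correlation of functions of nearly constant modulus *)

(** The arithmetic behind [correlation_lower_bound]: [u + i v] is the value of
    [g * g0^*] at a good point, [s] and [t] are the moduli of its factors, and
    [I + i J] is the integral. *)
Lemma modulus_lower_bound (R : realType) (u v s t I J N A B : R) :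
  `|s - 1| <= 100^-1 -> `|t - 1| <= 100^-1 ->
  `|u - A| <= 6 / 100 -> `|v - B| <= 6 / 100 ->
  `|I - A| <= 16 / 100 -> `|J - B| <= 16 / 100 ->
  `|I| <= N -> `|J| <= N -> (t * s) ^+ 2 = u ^+ 2 + v ^+ 2 -> 4^-1 <= N.
Proof.
rewrite !ler_norml => /andP[s1 s2] /andP[t1 t2] /andP[u1 u2] /andP[v1 v2].
move=> /andP[I1 I2] /andP[J1 J2] /andP[M1 M2] /andP[N1 N2] E.
rewrite leNgt; apply/negP => small.
have us : -47 / 100 <= u <= 47 / 100 by apply/andP; split; lra.
have vs : -47 / 100 <= v <= 47 / 100 by apply/andP; split; lra.
have st : 98 / 100 <= t * s by nra.
have u2' : u ^+ 2 <= 23 / 100 by nra.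
have v2' : v ^+ 2 <= 23 / 100 by nra.
nra.
Qed.

Section correlation_bound.
Context d (T : measurableType d) (R : realType) (mu : probability T R).
Implicit Types (f g : T -> R[i]).

Definition nearly_unimodular g := [set x | `|normc (g x) - 1| < 100^-1].

(** Truncation makes the function bounded, so that pairing with it is continuous on
    L^p for every p >= 1, also when the function is not in the dual space. *)
Definition conj_truncation g x : R[i] := (\1_(nearly_unimodular g) x)%:C * (g x)^*.

Lemma measurable_nearly_unimodular g : cmeasurable g -> measurable (nearly_unimodular g).
Proof.
move=> mg; rewrite (_ : nearly_unimodular g = ~` [set x | 100^-1 <= `|normc (g x) - 1|]).
  apply: measurableC; apply: measurable_ge; apply: measurableT_comp => //.
  by apply: measurable_funB => //; exact: measurable_normc.
by apply/seteqP; split=> x; rewrite /nearly_unimodular /= ltNge => /negP.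
Qed.

Lemma cmeasurable_conj_truncation g : cmeasurable g -> cmeasurable (conj_truncation g).
Proof.
move=> mg; have mE := measurable_nearly_unimodular mg.
apply: cmeasurableM.
  by split; [exact: measurable_indic|exact: measurable_cst].
split.
  rewrite (_ : _ \o _ = @complex.Re R \o g); first exact: mg.1.
  by apply/funext => x /=; case: (g x).
rewrite (_ : _ \o _ = -%R \o (@complex.Im R \o g)); first exact: measurableT_comp mg.2.
by apply/funext => x /=; case: (g x).
Qed.

Lemma normc_conj (z : R[i]) : normc z^* = normc z.
Proof. by case: z => a b; rewrite /normc /= sqrrN. Qed.

Lemma conj_truncation_le g x : normc (conj_truncation g x) <= 101 / 100.
Proof.
rewrite normcM normc_conj normc_real indicE.
have [|_] := boolP (x \in _); last by rewrite normr0 mul0r.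
rewrite inE /nearly_unimodular /= ltr_norml => /andP[_ h]; rewrite normr1 mul1r; lra.
Qed.

(** Off a small set all four moduli are almost constant, so by polarisation
    [g * g0^*] is almost a constant [A + i B], and its modulus is about 1. The
    integral is then close to [A + i B]. *)
Lemma correlation_lower_bound g0 g (a b : R) : cmeasurable g0 -> cmeasurable g ->
  (cLnorm mu 1 g <= 1)%E -> 0 <= a <= 2 -> 0 <= b <= 2 ->
  (mu [set x | (100^-1 <= `|normc (g0 x) - 1|)%R] <= (100^-1)%:E)%E ->
  (mu [set x | (100^-1 <= `|normc (g x) - 1|)%R] <= (100^-1)%:E)%E ->
  (mu [set x | (100^-1 <= `|normc (g0 x + g x) - a|)%R] <= (100^-1)%:E)%E ->
  (mu [set x | (100^-1 <= `|normc (g0 x + 'i%C * g x) - b|)%R] <= (100^-1)%:E)%E ->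
  4^-1 <= normc (cint mu (fun x => g x * conj_truncation g0 x)).
Proof.
move=> mg0 mg g1 a02 b02.
set B1 := [set x | _]; set B2 := [set x | _]; set B3 := [set x | _]; set B4 := [set x | _].
move=> mu1 mu2 mu3 mu4.
have mB (f : T -> R[i]) (c : R) : cmeasurable f ->
    measurable [set x | (100^-1 <= `|normc (f x) - c|)%R].
  move=> mf; apply: measurable_ge; apply: measurableT_comp => //.
  by apply: measurable_funB => //; exact: measurable_normc.
have mig : cmeasurable (fun x => 'i%C * g x).
  by apply: cmeasurableM => //; split; exact: measurable_cst.
have mB1 : measurable B1 by exact: mB.
have mB2 : measurable B2 by exact: mB.
have mB3 : measurable B3 by apply: mB; exact: cmeasurableD mg0 mg.
have mB4 : measurable B4 by apply: mB; exact: cmeasurableD mg0 mig.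
pose bad := (B1 `|` B2) `|` (B3 `|` B4).
have mbad : measurable bad by do !apply: measurableU.
have mubad : (mu bad <= (4 / 100)%:E)%E.
  have U2 (A B : set T) (s t : R) : measurable A -> measurable B ->
      (mu A <= s%:E -> mu B <= t%:E -> mu (A `|` B) <= (s + t)%:E)%E.
    move=> mA mB' As Bt; rewrite (le_trans (measureU2 _ _ _))//.
    by rewrite EFinD leeD.
  have -> : 4 / 100 = (100^-1 + 100^-1) + (100^-1 + 100^-1) :> R by lra.
  by apply: (U2); [exact: measurableU|exact: measurableU|exact: U2|exact: U2].
set k := conj_truncation g0; set F := fun x => g x * k x.
have mF : cmeasurable F by apply: cmeasurableM => //; exact: cmeasurable_conj_truncation.
have Fg x : normc (F x) <= 101 / 100 * normc (g x).
  by rewrite normcM mulrC ler_wpM2r ?normc_ge0// conj_truncation_le.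
have good x : ~ bad x -> [/\ F x = g x * (g0 x)^*,
    `|normc (g0 x) - 1| <= 100^-1, `|normc (g x) - 1| <= 100^-1,
    `|complex.Re (F x) - (a ^+ 2 / 2 - 1)| <= 6 / 100 &
    `|complex.Im (F x) - (1 - b ^+ 2 / 2)| <= 6 / 100].
  move=> nbad.
  have n1 : `|normc (g0 x) - 1| < 100^-1 by rewrite ltNge; apply/negP => h; apply: nbad; left; left.
  have n2 : `|normc (g x) - 1| < 100^-1 by rewrite ltNge; apply/negP => h; apply: nbad; left; right.
  have n3 : `|normc (g0 x + g x) - a| < 100^-1.
    by rewrite ltNge; apply/negP => h; apply: nbad; right; left.
  have n4 : `|normc (g0 x + 'i%C * g x) - b| < 100^-1.
    by rewrite ltNge; apply/negP => h; apply: nbad; right; right.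
  have FE : F x = g x * (g0 x)^*.
    by rewrite /F /k /conj_truncation indicE mem_set// mul1r.
  have [h1 h2] := polarisation_approx a02 b02 (ltW n1) (ltW n2) (ltW n3) (ltW n4).
  by rewrite FE; split=> //; exact: ltW.
have sq02 (c : R) : 0 <= c <= 2 -> 0 <= c ^+ 2 <= 4.
  by move=> /andP[c0 c2]; rewrite sqr_ge0 /=; nra.
have g99 x : `|normc (g x) - 1| <= 100^-1 -> 99 / 100 <= normc (g x).
  by rewrite ler_norml => /andP[h _]; lra.
have hr : `|\int[mu]_x complex.Re (F x) - (a ^+ 2 / 2 - 1)| <= 16 / 100.
  apply: (Rintegral_near mg g1 mF.1 mbad mubad).
  - by move=> x; exact: le_trans (Re_le_normc _) (Fg x).
  - by have /andP[] := sq02 _ a02; rewrite ler_norml; lra.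
  - by move=> x /good[_ _ /g99 h3 h4 _].
have hi : `|\int[mu]_x complex.Im (F x) - (1 - b ^+ 2 / 2)| <= 16 / 100.
  apply: (Rintegral_near mg g1 mF.2 mbad mubad).
  - by move=> x; exact: le_trans (Im_le_normc _) (Fg x).
  - by have /andP[] := sq02 _ b02; rewrite ler_norml; lra.
  - by move=> x /good[_ _ /g99 h3 _ h4].
have [x0 nbad] : exists x, ~ bad x.
  apply: contrapT => h.
  have badT : bad = setT by apply/seteqP; split=> // x _; apply: contrapT => nb; apply: h; exists x.
  move: mubad; rewrite badT probability_setT lee_fin; lra.
have [FE n1 n2 h1 h2] := good _ nbad.
have E := sqr_normcE (F x0); rewrite {1}FE normcM normc_conj in E.
have E1 : `|\int[mu]_x complex.Re (F x)| <= normc (cint mu F) := Re_le_normc (cint mu F).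
have E2 : `|\int[mu]_x complex.Im (F x)| <= normc (cint mu F) := Im_le_normc (cint mu F).
exact: modulus_lower_bound n1 n2 h1 h2 hr hi E1 E2 E.
Qed.

End correlation_bound.

(** * Hypercontractive operators are almost injective near the unit circle *)

Section Lspace_norm.
Context d (T : measurableType d) (R : realType) (mu : probability T R).
Context (p : R) (p1 : 1 <= p).
Local Notation X := (cLspace mu p1).
Implicit Types (u v : X).

Lemma Lspace_cmeasurable u : cmeasurable u.
Proof. exact: (cLfunP _).1. Qed.

Lemma nrm_Lspace u : (nrm u)%:E = cLnorm mu p u.
Proof. by rewrite -[RHS](fineK (cLnorm_fin_num _)). Qed.

Lemma Lspace_lin_ae (a : R[i]) u v :
  (a *: u + v : X) = (fun x => a * u x + v x) %[ae mu].
Proof.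
have E : a *: u + v = cLclass (a *: (u : cLfunType mu p1) + (v : cLfunType mu p1)).
  by rewrite pi_cD -[cLclass (a *: _)]/(Defs.cscale a u) cLclassK.
by rewrite E; exact: repr_ae.
Qed.

Lemma cLnorm1_le_nrm u : (cLnorm mu 1 u <= (nrm u)%:E)%E.
Proof. by rewrite nrm_Lspace; apply: cLnorm_homo => //; exact: Lspace_cmeasurable. Qed.

(** The functionals that detect approximate eigenvectors: [u] is first mapped by the
    contraction [A], then integrated against a bounded function. *)
Lemma pairing_functional (k : T -> R[i]) (M : R) (A : {linear X -> X}) :
  0 <= M -> cmeasurable k -> (forall x, normc (k x) <= M) ->
  (forall u, nrm (A u) <= nrm u) ->
  exists phi : {scalar X}, (forall u, phi u = cint mu (fun x => (A u : X) x * k x)) /\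
    forall u, normc (phi u) <= 2 * M * nrm u.
Proof.
move=> M0 mk kM contrA.
pose f u := cint mu (fun x => (A u : X) x * k x).
have mf u : cmeasurable (fun x => (A u : X) x * k x).
  by apply: cmeasurableM => //; exact: Lspace_cmeasurable.
have n1 u : (cLnorm mu 1 (fun x => ((A u : X) x * k x)%R) <= (M * nrm u)%:E)%E.
  have mAu := Lspace_cmeasurable (A u).
  rewrite -integral_normcE//.
  apply: (@le_trans _ _ (M%:E * cLnorm mu 1 (A u : X)))%E; last first.
    rewrite EFinM lee_wpmul2l ?lee_fin// (le_trans (cLnorm1_le_nrm _))//.
    by rewrite lee_fin contrA.
  rewrite -integral_normcE// -ge0_integralZl_EFin//; last 2 first.
  - by move=> x _; rewrite lee_fin normc_ge0.
  - exact/measurable_EFinP/measurable_normc.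
  apply: ge0_le_integral => //.
  - by move=> x _; rewrite lee_fin normc_ge0.
  - exact/measurable_EFinP/measurable_normc/mf.
  - by apply: emeasurable_funM => //; exact/measurable_EFinP/measurable_normc.
  - move=> x _; rewrite -EFinM lee_fin normcM mulrC.
    by rewrite ler_wpM2r ?normc_ge0.
have fin u : (cLnorm mu 1 (fun x => ((A u : X) x * k x)%R) < +oo)%E.
  by rewrite (le_lt_trans (n1 u))// ltry.
have linf : linear_for *%R f.
  move=> a u v; rewrite /f -cint_linear//; apply: cint_ae => //.
    have -> : (fun x => a * ((A u : X) x * k x) + (A v : X) x * k x) =
      a *: (fun x => (A u : X) x * k x) + (fun x => (A v : X) x * k x) by [].
    by apply: cmeasurableD => //; exact: cmeasurableZ.
  have := Lspace_lin_ae a (A u) (A v); rewrite linearP.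
  by apply: filterS => x /(_ I) -> _; rewrite mulrDl mulrA.
pose m := GRing.isLinear.Build R[i] X R[i] *%R f linf.
pose phi : {scalar X} := HB.pack f m.
exists phi; split=> // u; rewrite (le_trans (normc_cint_le (mf u) (fin u)))//.
rewrite -mulrA ler_wpM2l// -lee_fin fineK// ge0_fin_numE ?cLnorm_ge0//.
Qed.

End Lspace_norm.

Section key_estimate.
Context d (Omega : measurableType d) (R : realType) (mu : probability Omega R).
Context (p : R) (p1 : 1 <= p).
Local Notation X := (cLspace mu p1).
Context (T : {linear X -> X}).

Lemma hypercontractive_contraction : hypercontractive T -> forall u, nrm (T u) <= nrm u.
Proof.
move=> [q pq Tq] u; rewrite -lee_fin !nrm_Lspace.
apply: le_trans (Tq u).2; apply: cLnorm_homo (ltW pq) _.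
  exact: lt_le_trans p1.
exact: Lspace_cmeasurable.
Qed.

(** If no unit vector is an approximate eigenvector for [l] there is nothing to
    detect. Otherwise fix one, [f0]; the functional pairs [T f] with the truncation
    of [T f0]. For any other approximate eigenvector [f] of norm 1 the vectors
    [f0 + f] and [f0 + i f] are approximate eigenvectors as well, so [T] almost
    preserves the norms of all four, their images have nearly constant modulus, and
    [correlation_lower_bound] applies. *)
Theorem hypercontractive_almost_injective : hypercontractive T ->
  exists2 c : R, 0 < c & exists2 e : R, 0 < e &
    forall l : R[i], 1 - e <= normc l <= 1 -> almost_injective c T l.
Proof.
move=> hT; have contrT := hypercontractive_contraction hT.
have [q pq Tq] := hT.
have h100 : 0 < (100^-1 : R) <= 1 by apply/andP; split; lra.
have [e0 e00 He0] := near_constant_of_norms mu p1 pq h100.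
pose e := e0 / 4; have ep : 0 < e by rewrite divr_gt0.
exists (e^-1 + 4); first by rewrite addr_gt0 ?invr_gt0.
exists e => // l /andP[l1 l2].
pose N := spectral_shift T l.
have einv : 0 <= e^-1 by rewrite invr_ge0 ltW.
(* By homogeneity the estimate need only be proved for unit vectors. *)
have unit_case (M : X -> R) : (forall u t, 0 <= t -> M (t%:C *: u) = t * M u) ->
    (forall u, nrm u = 1 -> 1 <= (e^-1 + 4) * M u) ->
    forall u, nrm u <= (e^-1 + 4) * M u.
  move=> MZ M1 u; have [->|u0] := eqVneq u 0.
    have := MZ 0 0 (lexx _); rewrite scaler0 mul0r => ->.
    by rewrite nrm0 mulr0.
  have nu := nrm_gt0 u0.
  have := M1 ((nrm u)^-1%:C *: u).
  rewrite nrmZ normc_real ger0_norm ?invr_ge0 ?nrm_ge0// mulVf ?gt_eqF// => /(_ erefl).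
  rewrite MZ ?invr_ge0 ?nrm_ge0// mulrCA mulrC ler_pdivlMr// mul1r//.
have NZ (u : X) (t : R) : 0 <= t -> nrm (N (t%:C *: u)) = t * nrm (N u).
  by move=> t0; rewrite /N linearZ /= nrmZ normc_real ger0_norm.
have [[f0 f01 Nf0]|nof0] := pselect (exists2 f0 : X, nrm f0 = 1 & nrm (N f0) <= e); last first.
  pose z : X -> R[i] := fun=> 0.
  have linz : linear_for *%R z by move=> a u v; rewrite /z mulr0 addr0.
  pose m := GRing.isLinear.Build R[i] X R[i] *%R z linz.
  pose phi : {scalar X} := HB.pack z m.
  exists phi, 0 => //; split=> [u|]; first by rewrite mul0r normc0.
  have phi0 u : phi u = 0 by [].
  apply: unit_case => [u t t0|u u1].
    by rewrite NZ// !phi0 normc0 !addr0.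
  rewrite phi0 normc0 addr0.
  have h : e < nrm (N u) by rewrite ltNge; apply/negP => h; apply: nof0; exists u.
  rewrite mulrDl -/N.
  have h1 : 1 <= e^-1 * nrm (N u) by rewrite mulrC ler_pdivlMr// mul1r ltW.
  by have := nrm_ge0 (N u); lra.
pose g0 : X := T f0; have mg0 := Lspace_cmeasurable g0.
pose k := conj_truncation (g0 : Omega -> R[i]).
have h0 : 0 <= 101 / 100 :> R by lra.
have [phi [phiE bphi]] := pairing_functional h0 (cmeasurable_conj_truncation mg0)
  (conj_truncation_le (g0 : Omega -> R[i])) contrT.
exists phi, (2 * (101 / 100)); first by rewrite mulr_ge0.
split=> //.
apply: unit_case => [u t t0|f f1].
  by rewrite NZ// linearZ /= normcM normc_real ger0_norm// mulrDr.
rewrite -/N.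
have [Nf|Nf] := leP (nrm (N f)) e; last first.
  have h1 : 1 <= e^-1 * nrm (N f) by rewrite mulrC ler_pdivlMr// mul1r ltW.
  rewrite mulrDl; have := nrm_ge0 (N f); have := normc_ge0 (phi f).
  by move=> x0 y0; rewrite mulrDr; have := mulr_ge0 einv x0; lra.
suff : 4^-1 <= normc (phi f).
  have := nrm_ge0 (N f); move=> y0 x0.
  have := mulr_ge0 einv y0; have := mulr_ge0 einv (normc_ge0 (phi f)).
  by rewrite mulrDr !mulrDl; lra.
rewrite phiE.
have near_const (F : X) (G : Omega -> R[i]) : nrm F <= 2 -> nrm (N F) <= 2 * e ->
    cmeasurable G -> (T F : X) = G %[ae mu] ->
    (mu [set x | (100^-1 <= `|normc (G x) - nrm F|)%R] <= (100^-1)%:E)%E.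
  move=> F2 NF mG TG; have p0 : 0 < p := lt_le_trans ltr01 p1.
  apply: He0 => //.
  - by rewrite nrm_ge0.
  - rewrite -(cLnorm_ae (lt_trans p0 pq) (Lspace_cmeasurable (T F)) mG TG).
    by rewrite nrm_Lspace; exact: (Tq F).2.
  - rewrite -(cLnorm_ae p0 (Lspace_cmeasurable (T F)) mG TG) -nrm_Lspace lee_fin.
    have h1 : nrm (l *: F) <= nrm (T F) + nrm (N F) by exact: nrm_le_sub.
    have h2 : (1 - e) * nrm F <= normc l * nrm F by rewrite ler_wpM2r ?nrm_ge0.
    rewrite nrmZ in h1.
    have h3 : e * nrm F <= e * 2 by rewrite ler_wpM2l ?(ltW ep).
    have e4 : e0 = 4 * e by rewrite /e; field.
    by rewrite e4; lra.
have sum_const (c : R[i]) : normc c = 1 ->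
    (mu [set x | (100^-1 <= `|normc (g0 x + c * (T f : X) x) -
      nrm (c *: f + f0)|)%R] <= (100^-1)%:E)%E.
  move=> c1; apply: near_const.
  - by rewrite (le_trans (nrmD _ _))// nrmZ c1 f01 f1; lra.
  - rewrite /N linearD linearZ /= (le_trans (nrmD _ _))// nrmZ c1 mul1r.
    by rewrite -/N; lra.
  - have mTf := Lspace_cmeasurable (T f).
    exact: cmeasurableD mg0 (cmeasurableZ c mTf).
  - rewrite linearP; have := Lspace_lin_ae c (T f) (T f0).
    by apply: filterS => x /(_ I) -> _; rewrite addrC.
have bnd (c : R[i]) : normc c = 1 -> 0 <= nrm (c *: f + f0) <= 2.
  move=> c1; rewrite nrm_ge0 (le_trans (nrmD _ _))// nrmZ c1 f01 f1; lra.
have n1 : normc (1 : R[i]) = 1 := normc1 R.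
have ni : normc ('i%C : R[i]) = 1 by rewrite /normc /= expr0n add0r expr1n sqrtr1.
apply: (correlation_lower_bound mg0 (Lspace_cmeasurable (T f)) _ (bnd _ n1) (bnd _ ni)).
- by rewrite (le_trans (cLnorm1_le_nrm _))// lee_fin (le_trans (contrT f))// f1.
- have := near_const f0 g0; rewrite f01; apply=> //; [lra|lra|exact: nearW].
- have := near_const f (T f : X); rewrite f1.
  by apply=> //; [lra|lra|exact: Lspace_cmeasurable|exact: nearW].
- by have := sum_const _ n1; under eq_set do rewrite mul1r.
- exact: sum_const ni.
Qed.

End key_estimate.

(** * Completeness of L^p *)

Section limits.
Context (R : realType).

Lemma powR_continuous_at (a p : R) : 0 < a -> {for a, continuous (@powR R ^~ p)}.
Proof.
move=> a0; apply/differentiable_continuous/derivable1_diffP.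
by apply: derivable_powR; rewrite in_itv /= andbT.
Qed.

Lemma limn_einf_ge_cvg (u : (\bar R)^nat) (l : \bar R) :
  u @ \oo --> l -> (l <= limn_einf u)%E.
Proof. by move=> ul; have [-> _] := cvg_limn_einf_sup ul. Qed.

Lemma limn_einf_bounds (u : (\bar R)^nat) (a b : \bar R) :
  (forall n, a <= u n <= b)%E -> (a <= limn_einf u <= b)%E.
Proof.
move=> ab; rewrite limn_einf_lim; apply/andP; split.
  apply: lime_ge; first exact: is_cvg_einfs.
  apply: nearW => n; apply: le_ereal_inf_tmp => _ [m _ <-].
  by have /andP[] := ab m.
apply: lime_le; first exact: is_cvg_einfs.
apply: nearW => n; have /andP[_] := ab n; apply: le_trans.
by apply: ereal_inf_lbound; exists n => //=.
Qed.

Lemma normc_cvg (u : nat -> R[i]) (l : R[i]) :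
  (complex.Re (u n) @[n --> \oo] --> complex.Re l) ->
  (complex.Im (u n) @[n --> \oo] --> complex.Im l) ->
  normc (u n) @[n --> \oo] --> normc l.
Proof.
move=> ur ui.
have E (z : R[i]) : normc z = Num.sqrt (complex.Re z ^+ 2 + complex.Im z ^+ 2) by case: z.
rewrite E; under eq_fun do rewrite E.
apply: continuous_cvg; first exact: sqrt_continuous.
by apply: cvgD; rewrite !expr2; under eq_fun do rewrite expr2; apply: cvgM.
Qed.

End limits.

Section fatou_norm.
Context d (T : measurableType d) (R : realType) (mu : {measure set T -> \bar R}).

(** Fatou's lemma for the powers of the moduli. *)
Lemma cLnorm_limit_le (p e : R) (G : nat -> T -> R[i]) (F : T -> R[i]) :
  0 < p -> 0 < e -> (forall k, cmeasurable (G k)) -> cmeasurable F ->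
  (forall k, (cLnorm mu p (G k) <= e%:E)%E) ->
  {ae mu, forall x, (complex.Re (G k x) @[k --> \oo] --> complex.Re (F x)) /\
                    (complex.Im (G k x) @[k --> \oo] --> complex.Im (F x))} ->
  (cLnorm mu p F <= e%:E)%E.
Proof.
move=> p0 e0 mG mF Ge GF; apply/cLnorm_leP => //.
pose D k x := ((normc (G k x) / e) `^ p)%:E.
have mD k : measurable_fun setT (D k).
  apply/measurable_EFinP/measurable_powRf; apply: measurable_funM => //.
  exact: measurable_normc.
have D0 k x : setT x -> (0 <= D k x)%E by move=> _; rewrite lee_fin powR_ge0.
have h1 : (\int[mu]_x limn_einf (D ^~ x) <= 1)%E.
  apply: le_trans (fatou mu measurableT mD D0) _.
  have /(_ 0%E 1%E) := @limn_einf_bounds R (fun k => \int[mu]_x D k x)%E.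
  case/(_ _)/andP => // k; apply/andP; split; first by apply: integral_ge0 => x _; exact: D0.
  exact/cLnorm_leP.
apply: le_trans h1; apply: ae_ge0_le_integral => //.
- by move=> x _; rewrite lee_fin powR_ge0.
- apply/measurable_EFinP/measurable_powRf; apply: measurable_funM => //.
  exact: measurable_normc.
- move=> x _; have /(_ 0%E +oo%E) := @limn_einf_bounds R (D ^~ x).
  by case/(_ _)/andP => // k; rewrite D0// leey.
- apply: (@emeasurable_fun_cvg _ _ _ _ (fun n x => einfs (D ^~ x) n)).
    by move=> n; exact: measurable_fun_einfs.
  by move=> x _; rewrite limn_einf_lim; exact: is_cvg_einfs.
apply: filterS GF => x [xr xi] _.
(* Where the limit vanishes there is nothing to prove; elsewhere the power function
   is continuous at it. *)
have [a0|a0] := eqVneq (normc (F x) / e) 0.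
  rewrite a0 powR0 ?gt_eqF//.
  have /(_ 0%E +oo%E) := @limn_einf_bounds R (D ^~ x).
  by case/(_ _)/andP => // k; rewrite D0// leey.
apply: limn_einf_ge_cvg; apply: cvg_EFin; first exact: nearW.
have -> : fine \o D ^~ x = (fun k => (normc (G k x) / e) `^ p) by [].
apply: (@continuous_cvg nat R R _ _ (fun k => normc (G k x) / e) (fun y => y `^ p)).
  by apply: powR_continuous_at; rewrite lt_neqAle eq_sym a0 divr_ge0 ?normc_ge0// ltW.
by apply: cvgMl; exact: normc_cvg.
Qed.

End fatou_norm.

Section Lspace_completeness.
Context d (T : measurableType d) (R : realType) (mu : probability T R).
Context (p : R) (p1 : 1 <= p).
Local Notation X := (cLspace mu p1).

(** The sum of the moduli has a finite integral by monotone convergence, so it is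
    finite almost everywhere. *)
Lemma absolutely_summable_ae (f : nat -> T -> R[i]) (M : R) :
  (forall i, cmeasurable (f i)) ->
  (forall n, \sum_(i < n) cLnorm mu 1 (f i) <= M%:E)%E ->
  {ae mu, forall x, cvgn (series (fun i => normc (f i x)))}.
Proof.
move=> mf fM.
pose S x := (\sum_(i <oo) (normc (f i x))%:E)%E.
have mn i : measurable_fun setT (fun x => (normc (f i x))%:E).
  exact/measurable_EFinP/measurable_normc.
have mS : measurable_fun setT S.
  apply: (@emeasurable_fun_cvg _ _ _ _ (fun n x => \sum_(0 <= i < n) (normc (f i x))%:E)%E).
    by move=> n; apply: emeasurable_sum => i; exact: mn.
  by move=> x _; apply: is_cvg_nneseries => n _ _; rewrite lee_fin normc_ge0.
have S0 x : (0 <= S x)%E by apply: nneseries_ge0 => n _ _; rewrite lee_fin normc_ge0.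
have iS : (\int[mu]_x S x <= M%:E)%E.
  rewrite integral_nneseries//; last by move=> n x _; rewrite lee_fin normc_ge0.
  apply: lime_le.
    apply: is_cvg_nneseries => n _ _; apply: integral_ge0 => x _.
    by rewrite lee_fin normc_ge0.
  apply: nearW => n; rewrite big_mkord; apply: le_trans (fM n).
  by apply: lee_sum => i _; rewrite integral_normcE.
have intS : mu.-integrable setT S.
  apply/integrableP; split => //.
  under eq_integral => x _ do rewrite gee0_abs//.
  by rewrite (le_lt_trans iS)// ltry.
have := integrable_ae measurableT intS; apply: filterS => x /(_ I).
rewrite ge0_fin_numE// => Sx.
by apply: nnseries_is_cvg => // i; exact: normc_ge0.
Qed.

Lemma Re_sum n (z : nat -> R[i]) :
  complex.Re (\sum_(i < n) z i) = \sum_(i < n) complex.Re (z i).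
Proof.
elim: n => [|n IHn]; first by rewrite !big_ord0.
by rewrite !big_ord_recr /= -IHn; case: (\sum_(i < n) _); case: (z n).
Qed.

Lemma Im_sum n (z : nat -> R[i]) :
  complex.Im (\sum_(i < n) z i) = \sum_(i < n) complex.Im (z i).
Proof.
elim: n => [|n IHn]; first by rewrite !big_ord0.
by rewrite !big_ord_recr /= -IHn; case: (\sum_(i < n) _); case: (z n).
Qed.

Lemma series_ae_limit (f : nat -> T -> R) (g : nat -> T -> R) :
  (forall i, measurable_fun setT (f i)) -> (forall i x, `|f i x| <= g i x) ->
  (forall i, measurable_fun setT (g i)) ->
  {ae mu, forall x, cvgn (series (fun i => g i x))} ->
  exists2 F : T -> R, measurable_fun setT F &
    {ae mu, forall x, \sum_(i < n) f i x @[n --> \oo] --> F x}.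
Proof.
move=> mf fg mg cg.
pose S n x := \sum_(i < n) f i x.
have mS n : measurable_fun setT (S n) by exact: measurable_sum.
(* The upper limit is measurable whether or not the series converges. *)
exists (fun x => fine (limn_esup (fun n => (S n x)%:E))).
  apply: measurableT_comp; first exact: fine_measurable.
  by apply: measurable_fun_limn_esup => n; exact/measurable_EFinP.
apply: filterS cg => x cgx.
have cS : cvgn (S ^~ x).
  have -> : S ^~ x = series (fun i => f i x) by apply/funext => n; rewrite /series /= big_mkord.
  apply: normed_cvg; apply: series_le_cvg cgx => i; [exact: normr_ge0| |exact: fg].
  by apply: le_trans (fg i x).
have cE : (S n x)%:E @[n --> \oo] --> (limn (S ^~ x))%:E.
  by apply: cvg_EFin => //; exact: nearW.
rewrite (is_cvg_limn_esupE _); last by apply/cvg_ex; eexists; exact: cE.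
by move/cvg_lim : cE => ->.
Qed.

(** The Riesz-Fischer theorem: a series of classes whose norms are summable
    converges absolutely at almost every point, and by Fatou its pointwise sum is
    its sum in norm. *)
Theorem Lspace_complete : summable_series_converge X.
Proof.
have p0 : 0 < p := lt_le_trans ltr01 p1.
move=> u M uM; pose f i : T -> R[i] := (u i : X).
have mf i : cmeasurable (f i) by exact: Lspace_cmeasurable.
have fM n : (\sum_(i < n) cLnorm mu 1 (f i) <= M%:E)%E.
  apply: (@le_trans _ _ (\sum_(i < n) (nrm (u i))%:E)%E).
    by apply: lee_sum => i _; exact: cLnorm1_le_nrm.
  by rewrite sumEFin lee_fin.
have cf := absolutely_summable_ae mf fM.
have mnf i : measurable_fun setT (fun x => normc (f i x)) by exact: measurable_normc.
have [Fr mFr cFr] := series_ae_limit (fun i => (mf i).1) (fun i x => Re_le_normc (f i x)) mnf cf.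
have [Fi mFi cFi] := series_ae_limit (fun i => (mf i).2) (fun i x => Im_le_normc (f i x)) mnf cf.
pose F x : R[i] := Fr x +i* Fi x.
have mF : cmeasurable F by split.
pose s n : X := \sum_(i < n) u i.
pose sg n x := \sum_(i < n) f i x.
have ssg n : s n = sg n %[ae mu].
  elim: n => [|n IHn].
    rewrite /s big_ord0 -(pi_c0 mu p1).
    by apply: filterS (repr_ae (0 : cLfunType mu p1)) => x /(_ I) -> _; rewrite /sg big_ord0.
  rewrite /s big_ord_recr /= -/(s n) -[s n]scale1r.
  apply: filterS2 IHn (Lspace_lin_ae 1 (s n) (u n)) => x /(_ I) E1 /(_ I) -> _.
  by rewrite mul1r E1 /sg big_ord_recr.
have msg n : cmeasurable (sg n).
  elim: n => [|n IHn].
    by rewrite (_ : sg 0%N = 0); [exact: cmeasurable0|apply/funext => x; rewrite /sg big_ord0].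
  rewrite (_ : sg n.+1 = sg n + f n); first exact: cmeasurableD.
  by apply/funext => x; rewrite /sg big_ord_recr.
have mB (G H : T -> R[i]) : cmeasurable G -> cmeasurable H -> cmeasurable (fun x => G x - H x).
  move=> mG mH; rewrite (_ : (fun x => _) = G + (-1) *: H).
    by apply: cmeasurableD => //; exact: cmeasurableZ.
  by apply/funext => x; rewrite -[RHS]/(G x + -1 * H x) mulN1r.
have diff_ae (v w : X) (G H : T -> R[i]) : v = G %[ae mu] -> w = H %[ae mu] ->
    (v - w : X) = (fun x => G x - H x) %[ae mu].
  move=> vG wH; rewrite addrC -scaleN1r.
  have := Lspace_lin_ae (-1) w v.
  apply: filterS3 vG wH => x /(_ I) E1 /(_ I) E2 /(_ I) -> _.
  by rewrite E1 E2 mulN1r addrC.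
pose t n := \sum_(i < n) nrm (u i).
have t_le n k : t n <= t (n + k)%N.
  elim: k => [|k IHk]; first by rewrite addn0.
  by rewrite addnS /t big_ord_recr /= (le_trans IHk)// lerDl nrm_ge0.
have s_le n k : nrm (s (n + k)%N - s n) <= t (n + k)%N - t n.
  elim: k => [|k IHk]; first by rewrite addn0 !subrr nrm0.
  rewrite addnS /s /t !big_ord_recr /= -/(s _) -/(t _) addrAC [leRHS]addrAC.
  by rewrite (le_trans (nrmD _ _))// lerD2r.
have tail (e : R) : 0 < e -> exists N, forall n k, (N <= n)%N -> nrm (s (n + k)%N - s n) <= e.
  move=> e0; have hs : has_sup (range t).
    by split; [exists (t 0%N); exists 0%N|exists M => _ [n _ <-]; exact: uM].
  have [_ [N _ <-] hN] := sup_adherent e0 hs.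
  exists N => n k Nn; rewrite (le_trans (s_le n k))//.
  have h1 : t (n + k)%N <= sup (range t) by apply: (ub_le_sup hs.2); exists (n + k)%N.
  have h2 : t N <= t n by rewrite -(subnKC Nn) t_le.
  lra.
have close (e : R) : 0 < e -> exists N, forall n, (N <= n)%N ->
    (cLnorm mu p (fun x => (F x - sg n x)%R) <= e%:E)%E.
  move=> e0; have [N HN] := tail e e0.
  exists N => n Nn.
  apply: (@cLnorm_limit_le _ _ _ _ p e (fun k x => sg (n + k)%N x - sg n x)) => //.
  - by move=> k; exact: mB.
  - exact: mB.
  - move=> k; have E := diff_ae _ _ _ _ (ssg (n + k)%N) (ssg n).
    rewrite -(cLnorm_ae p0 (Lspace_cmeasurable (s (n + k)%N - s n)) _ E).
      by rewrite -nrm_Lspace lee_fin HN.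
    exact: mB.
  - apply: filterS2 cFr cFi => x cr ci.
    have ReB (a b : R[i]) : complex.Re (a - b) = complex.Re a - complex.Re b by case: a; case: b.
    have ImB (a b : R[i]) : complex.Im (a - b) = complex.Im a - complex.Im b by case: a; case: b.
    have Resg m : complex.Re (sg m x) = \sum_(i < m) complex.Re (f i x).
      exact: (Re_sum m (fun i => f i x)).
    have Imsg m : complex.Im (sg m x) = \sum_(i < m) complex.Im (f i x).
      exact: (Im_sum m (fun i => f i x)).
    split; rewrite ?ReB ?ImB.
      under eq_fun do rewrite ReB.
      apply: cvgB; last exact: cvg_cst.
      under eq_fun do rewrite Resg addnC.
      by move: cr; rewrite -(cvg_shiftn n (fun m => \sum_(i < m) complex.Re (f i x))).
    under eq_fun do rewrite ImB.
    apply: cvgB; last exact: cvg_cst.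
    under eq_fun do rewrite Imsg addnC.
      by move: ci; rewrite -(cvg_shiftn n (fun m => \sum_(i < m) complex.Im (f i x))).
have LF : F \in cLfun_pred mu p1.
  rewrite cLfun_predE inE; split=> //.
  have [N /(_ N (leqnn N)) HN] := close 1 ltr01.
  have -> : F = (fun x => F x - sg N x) + sg N by apply/funext => x; rewrite !fctE subrK.
  apply: le_lt_trans (cLnormD mu p1 (mB _ _ mF (msg N)) (msg N)) _.
  rewrite lte_add_pinfty// ?(le_lt_trans HN) ?ltry//.
  rewrite -(cLnorm_ae p0 (Lspace_cmeasurable (s N)) (msg N) (ssg N)).
  by rewrite -nrm_Lspace ltry.
pose y : X := cLclass (CLfun LF).
exists y => e e0; have [N HN] := close e e0.
exists N => n Nn; rewrite -lee_fin nrm_Lspace.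
have yF : y = F %[ae mu] by exact: (repr_ae (CLfun LF)).
rewrite (cLnorm_ae p0 (Lspace_cmeasurable _) _ (diff_ae _ _ _ _ yF (ssg n))); first exact: HN.
exact: mB.
Qed.

End Lspace_completeness.

(** * The theorem *)

Local Close Scope complex_scope.
Local Close Scope classical_set_scope.
Unset Implicit Arguments.

Theorem corollary4p6 (R : realType) (d : measure_display)
    (Omega : measurableType d) (mu : probability Omega R) (p : R) (p1 : 1 < p)
    (T : {linear cLspace mu (ltW p1) -> cLspace mu (ltW p1)})
    (T_bounded : bounded_op T) (T_hyper : hypercontractive T) :
  (ess_spectral_radius T < 1)%E.
Proof.
have [c c0 [e e0 almost_inj]] := hypercontractive_almost_injective T_hyper.
have [r r1 rT] := spectral_gap (@Lspace_complete _ _ _ mu p (ltW p1)) c0 e0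
  (hypercontractive_contraction T_hyper) almost_inj.
apply: (@le_lt_trans _ _ r%:E); last by rewrite lte_fin.
by apply: ereal_inf_lbound; exists r.
Qed.
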